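(* Let $\mathbb{F}$ be a field of characteristic $2$. Let $V$ be a finite-dimensional vector space over $\mathbb{F}$ and $b$ a non-degenerate symmetric bilinear form on $V$, with attached quadratic form $Q : x \mapsto b(x,x)$. Let $\nu$ be the Witt index of $b$ and $n := \dim V$. (a) The greatest dimension of a nilpotent linear subspace of $\mathcal{S}_b$ is $\nu(n-\nu)$. (b) If $n \neq 2\nu+1$, the greatest dimension of a nilpotent linear subspace of $\mathcal{A}_b$ is $\nu(n-\nu-1)$. (c) If $n = 2\nu+1$, the greatest dimension of a nilpotent linear subspace of $\mathcal{A}_b$ is $\nu(n-\nu) - \dim \operatorname{SKer} Q$.
   Context: An endomorphism $u$ of $V$ is $b$-symmetric (resp. $b$-alternating) if the bilinear form $(x,y)\mapsto b(x,u(y))$ is symmetric (resp. alternating, i.e. vanishes on all pairs $(x,x)$). $\mathcal{S}_b$ (resp. $\mathcal{A}_b$) denotes the linear subspace of $\operatorname{End}(V)$ consisting of $b$-symmetric (resp. $b$-alternating) endomorphisms. A linear subspace is nilpotent if all its elements are nilpotent. A subspace $X$ is totally $b$-singular if $b(x,y)=0$ for all $x,y\in X$; the Witt index $\nu(b)$ is the greatest dimension of a totally $b$-singular subspace. In characteristic $2$, $Q$ is additive and $\operatorname{Ker} Q = \{x \in V : Q(x)=0\}$ is a linear subspace; $\operatorname{SKer} Q := \operatorname{Ker} Q \cap (\operatorname{Ker} Q)^{\perp}$, where $X^\perp = \{y \in V : b(x,y)=0 \ \forall x\in X\}$. *)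

(* Defs.v *)
From mathcomp Require Import all_boot all_order all_algebra.
Set Implicit Arguments. Unset Strict Implicit. Unset Printing Implicit Defensive.
Import GRing.Theory.
Local Open Scope ring_scope.

Section BilinearDefs.
Variables (F : fieldType) (V : vectType F).
Implicit Types (b : V -> V -> F) (u : 'End(V)).

Definition pilot_bil_form b :=
  (forall a x y z, b (a *: x + y) z = a * b x z + b y z) /\
  (forall a x y z, b x (a *: y + z) = a * b x y + b x z).

Definition pilot_sym_form b := forall x y, b x y = b y x.

Definition pilot_nondegenerate b := forall x, (forall y, b x y = 0) -> x = 0.

Definition pilot_quad_form b (x : V) : F := b x x.

Definition pilot_totally_singular b (X : {vspace V}) :=
  forall x y, x \in X -> y \in X -> b x y = 0.

Definition pilot_greatest_dim (W : vectType F) (P : {vspace W} -> Prop) (d : nat) :=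
  (exists2 X : {vspace W}, P X & \dim X = d) /\
  (forall X : {vspace W}, P X -> (\dim X <= d)%N).

Definition pilot_witt_index b (nu : nat) := pilot_greatest_dim (pilot_totally_singular b) nu.

Definition pilot_b_symmetric b u := forall x y, b x (u y) = b y (u x).

Definition pilot_b_alternating b u := forall x, b x (u x) = 0.

Definition pilot_nilpotent_endo u := exists k : nat, forall x, iter k u x = 0.

Definition pilot_nilpotent_subspace (X : {vspace 'End(V)}) :=
  forall u, u \in X -> pilot_nilpotent_endo u.

Definition pilot_sub_Sb b (X : {vspace 'End(V)}) := forall u, u \in X -> pilot_b_symmetric b u.
Definition pilot_sub_Ab b (X : {vspace 'End(V)}) := forall u, u \in X -> pilot_b_alternating b u.

Definition pilot_is_SKer b (K : {vspace V}) :=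
  forall x, x \in K <->
    (pilot_quad_form b x = 0 /\ forall y, pilot_quad_form b y = 0 -> b y x = 0).

End BilinearDefs.

(* Main.v *)
From HB Require Import structures.
From mathcomp Require Import all_boot all_order all_algebra.
From mathcomp Require Import ring zify.
From Stdlib Require Import Classical.
Require Import Defs.
Set Implicit Arguments. Unset Strict Implicit. Unset Printing Implicit Defensive.
Import GRing.Theory.
Local Open Scope ring_scope.

(** Induction on the Witt index of a nondegenerate subspace W of V. Let x in W be a
nonzero singular vector, z in W with b(x,z) = 1, and W' the orthogonal of the plane <x,z>
in W: its dimension is dim W - 2 and its Witt index is nu - 1. If A is a nilpotent space
of symmetric endomorphisms with values in W, then dim A = dim Ax + dim K + dim A', where
A' is the compression to W' of the stabilizer {u in A : u x = 0} and K is the kernel of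
this compression, which consists of the rank 2 operators u |-> b(y,u) x + b(x,u) y + c
b(x,u) x with y in W'.

For the upper bounds, in characteristic 2 the trace form only says c b(x,wx) = 0 for w in
A. The missing information comes from det(1 - s(w+v)) = det(1 - sw) for v in K, which
unfolds into b(wx,y)^2 = b(x,wx) b(y,wy) + Q(wx) Q(y) + c b(x,w^3 x) and two lower-order
identities. These make a hyperplane of Ax orthogonal to all the vectors y, hence dim Ax +
dim K <= dim W - 1. For alternating operators one dimension more is gained if x lies in
SKer Q, for then Q(wx) = 0; if SKer Q = 0 and dim W <> 2 nu + 1, it is gained by adding a
vector of (Ker Q)^perp to the vectors y.

For the lower bounds, the same decomposition is run backwards. When dim W = 2 nu + 1 and
SKer Q = 0, one has W = Ker Q + <d> with d orthogonal to Ker Q and Q(d) <> 0, and the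
operators u |-> b(d,u) y + b(y,u) d with y in Ker Q are added to an optimal space on Ker
Q. *)

(** * Linear algebra preliminaries *)

Lemma linfun_funE (F : fieldType) (U V : vectType F) (f : U -> V) :
  linear f -> linfun f =1 f.
Proof.
move=> lf x; pose g : {linear U -> V} :=
  HB.pack f (GRing.isLinear.Build F U V *:%R f lf).
exact: (lfunE g x).
Qed.

Section VectorSpaces.
Variables (F : fieldType) (V : vectType F).

Lemma dim_add_line (X : {vspace V}) x : x \notin X -> \dim (X + <[x]>) = (\dim X).+1.
Proof.
move=> xX; rewrite dimv_disjoint_sum ?dim_vline.
  have -> : x != 0 by apply: contraNneq xX => ->; rewrite mem0v.
  by rewrite addn1.
apply/eqP; rewrite -subv0; apply/subvP=> y; rewrite memv_cap memv0.
case/andP=> yX /vlineP[a ya]; rewrite ya; case: (eqVneq a 0) => [->|a0]; first by rewrite scale0r.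
by move: yX; rewrite ya rpredZeq (negPf a0) (negPf xX).
Qed.

(** A subspace inside [P] that misses a vector of [P] can be enlarged by it; [k] bounds the
    codimension left, so this stops. *)
Lemma vspace_of_pred (P : V -> Prop) :
  P 0 -> (forall a x y, P x -> P y -> P (a *: x + y)) ->
  exists X : {vspace V}, forall x, x \in X <-> P x.
Proof.
move=> P0 PD.
suff H k (X : {vspace V}) : (forall x, x \in X -> P x) ->
    (\dim {:V} - \dim X <= k)%N ->
    exists X : {vspace V}, forall x, x \in X <-> P x.
  apply: (H (\dim {:V}) 0%VS) => [x|]; first by rewrite memv0 => /eqP->.
  exact: leq_subr.
elim: k X => [|k IH] X XP dX;
  have [[x [Px xX]]|nx] := classic (exists x, P x /\ x \notin X).
- have : (X == fullv)%VS by rewrite eqEdim subvf; lia.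
  by move/eqP=> XV; rewrite XV memvf in xX.
- exists X => x; split; first exact: XP.
  by move=> Px; apply/negPn/negP => xX; apply: nx; exists x.
- apply: (IH (<[x]> + X)%VS) => [y /memv_addP[_ /vlineP[a ->] [t tX ->]]|].
    exact: PD (Px) (XP _ tX).
  by rewrite addvC dim_add_line //; lia.
- exists X => x; split; first exact: XP.
  by move=> Px; apply/negPn/negP => xX; apply: nx; exists x.
Qed.

Lemma dim_cap_lker_form (X : {vspace V}) (h : 'Hom(V, F^o)) :
  (\dim X <= (\dim (X :&: lker h)).+1)%N.
Proof.
rewrite -(limg_ker_dim h X) -addn1 leq_add2l.
by apply: leq_trans (dimvS (subvf _)) _; rewrite dimvf.
Qed.

Lemma iter_lfunD (u : 'End(V)) k x y : iter k u (x + y) = iter k u x + iter k u y.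
Proof. by elim: k => //= k ->; rewrite linearD. Qed.

Lemma iter_lfunZ (u : 'End(V)) k a x : iter k u (a *: x) = a *: iter k u x.
Proof. by elim: k => //= k ->; rewrite linearZ. Qed.

Lemma iter_lfun0 (u : 'End(V)) k : iter k u 0 = 0.
Proof. by elim: k => //= k ->; rewrite linear0. Qed.

Lemma nilp_iter_ge (u : 'End(V)) k l x :
  (forall y, iter k u y = 0) -> (k <= l)%N -> iter l u x = 0.
Proof. by move=> u0 kl; rewrite -(subnK kl) iterD u0 iter_lfun0. Qed.

Lemma nilp_fix0 (u : 'End(V)) x a : a != 0 -> pilot_nilpotent_endo u -> u x = a *: x -> x = 0.
Proof.
move=> a0 [k uk] ux; have : iter k u x = a ^+ k *: x.
  by elim: (k) => [|j /= ->]; rewrite ?expr0 ?scale1r // linearZ /= ux scalerA exprSr.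
by rewrite uk => /esym/eqP; rewrite scaler_eq0 expf_eq0 (negPf a0) andbF => /eqP.
Qed.

End VectorSpaces.

(** * Symmetric bilinear forms, orthogonality and hyperbolic planes *)

Section SymmetricForm.
Variables (F : fieldType) (V : vectType F) (b : V -> V -> F).
Hypotheses (bil : pilot_bil_form b) (sym : pilot_sym_form b).

Lemma formDl x y z : b (x + y) z = b x z + b y z.
Proof. by rewrite -[x in LHS]scale1r (proj1 bil) mul1r. Qed.
Lemma form0l z : b 0 z = 0.
Proof. by apply: (@addIr _ (b 0 z)); rewrite -formDl !add0r. Qed.
Lemma formZl a x z : b (a *: x) z = a * b x z.
Proof. by rewrite -[_ *: _]addr0 (proj1 bil) form0l addr0. Qed.
Lemma formDr x y z : b z (x + y) = b z x + b z y.
Proof. by rewrite !(sym z) formDl. Qed.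
Lemma form0r z : b z 0 = 0.
Proof. by rewrite sym form0l. Qed.
Lemma formZr a x z : b z (a *: x) = a * b z x.
Proof. by rewrite !(sym z) formZl. Qed.
Definition formE := (formDl, formDr, formZl, formZr, form0l, form0r).
Lemma form_suml n (f : 'I_n -> V) z : b (\sum_i f i) z = \sum_i b (f i) z.
Proof. exact: (big_morph (b^~ z) (fun x y => formDl x y z) (form0l z)). Qed.
Lemma form_sumr n (f : 'I_n -> V) z : b z (\sum_i f i) = \sum_i b z (f i).
Proof. by rewrite sym form_suml; apply: eq_bigr => i _; rewrite sym. Qed.

Definition form_hom (x : V) : 'Hom(V, F^o) := linfun (b x : V -> F^o).
Lemma form_homE x y : form_hom x y = b x y.
Proof. by apply: linfun_funE => a u v; rewrite formDr formZr. Qed.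
Lemma mem_hyp x y : (y \in lker (form_hom x)) = (b x y == 0).
Proof. by rewrite memv_ker form_homE. Qed.

(** Encoded as the kernel of the pairing with a basis of [A], with values in dimension [\dim A], so
    that rank-nullity bounds the codimension in any [W]. *)
Definition orthv (A : {vspace V}) : {vspace V} :=
  lker (linfun (fun y => \row_(i < \dim A) b (vbasis A)`_i y)).

Lemma mem_orthv A y : y \in orthv A <-> forall a, a \in A -> b a y = 0.
Proof.
rewrite memv_ker linfun_funE; last first.
  by move=> a u v; apply/rowP=> i; rewrite !mxE formDr formZr.
split=> [/eqP/rowP y0 a aA|y0].
  rewrite (coord_vbasis aA) form_suml big1 // => i _; rewrite formZl.
  by have := y0 i; rewrite !mxE => ->; rewrite mulr0.
apply/eqP/rowP=> i; rewrite !mxE y0 //; apply: vbasis_mem.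
by apply: mem_nth; rewrite size_tuple.
Qed.

Lemma dim_cap_orthv W A : (\dim W <= \dim (W :&: orthv A) + \dim A)%N.
Proof.
rewrite /orthv; set f := linfun _.
rewrite -(limg_ker_dim f W) leq_add2l.
by apply: leq_trans (dimvS (subvf _)) _; rewrite dimvf /dim /= mul1n.
Qed.

Definition nondeg_on (W : {vspace V}) :=
  forall x, x \in W -> (forall y, y \in W -> b x y = 0) -> x = 0.

(** Nondegeneracy on [W] makes the Gram matrix [G] of [A] against a basis of [W] row free; the
    coordinate matrix [C] of [B] is row free too, and orthogonality reads [C *m G^T = 0]. *)
Lemma dim_orth_le W A B : nondeg_on W -> (A <= W)%VS -> (B <= W)%VS ->
  (forall a c, a \in A -> c \in B -> b a c = 0) -> (\dim A + \dim B <= \dim W)%N.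
Proof.
move=> ndW AW BW AB.
pose G := \matrix_(i < \dim A, j < \dim W) b (vbasis A)`_i (vbasis W)`_j.
pose C := \matrix_(i < \dim B, j < \dim W) coord (vbasis W) j (vbasis B)`_i.
have inA (i : 'I_(\dim A)) : (vbasis A)`_i \in A.
  by apply: vbasis_mem; apply: mem_nth; rewrite size_tuple.
have inB (i : 'I_(\dim B)) : (vbasis B)`_i \in B.
  by apply: vbasis_mem; apply: mem_nth; rewrite size_tuple.
have rG : row_free G.
  apply: inj_row_free => v vG.
  have /freeP fA := basis_free (vbasisP A).
  have v0 : \sum_i v 0 i *: (vbasis A)`_i = 0.
    apply: ndW => [|y yW].
      by apply: memv_suml => i _; apply: memvZ; apply: (subvP AW).
    rewrite (coord_vbasis yW) form_sumr big1 // => j _; rewrite formZr.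
    have := congr1 (fun M : 'rV_(\dim W) => M 0 j) vG; rewrite !mxE => vGj.
    rewrite form_suml (eq_bigr (fun i => v 0 i * G i j)) ?vGj ?mulr0 //.
    by move=> i _; rewrite formZl mxE.
  by apply/rowP=> i; rewrite mxE (fA _ v0).
have rC : row_free C.
  apply: inj_row_free => v vC.
  have /freeP fB := basis_free (vbasisP B).
  have v0 : \sum_i v 0 i *: (vbasis B)`_i = 0.
    have sW : \sum_i v 0 i *: (vbasis B)`_i \in W.
      by apply: memv_suml => i _; apply: memvZ; apply: (subvP BW).
    rewrite (coord_vbasis sW) big1 // => j _.
    have := congr1 (fun M : 'rV_(\dim W) => M 0 j) vC; rewrite !mxE => vCj.
    rewrite linear_sum (eq_bigr (fun i => v 0 i * C i j)) ?vCj ?scale0r //.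
    by move=> i _; rewrite linearZ mxE.
  by apply/rowP=> i; rewrite mxE (fB _ v0).
have CG : C *m G^T = 0.
  apply/matrixP=> i j; rewrite !mxE -[RHS](AB _ _ (inA j) (inB i)).
  rewrite [in RHS](coord_vbasis (subvP BW _ (inB i))) form_sumr.
  by apply: eq_bigr => k _; rewrite !mxE formZr.
have := mulmx0_rank_max CG; rewrite mxrank_tr.
by move/eqP: rG => ->; move/eqP: rC => ->; rewrite addnC.
Qed.

Definition rank1 (x y : V) : 'End(V) := linfun (fun u => b x u *: y).

Lemma rank1E x y u : rank1 x y u = b x u *: y.
Proof.
apply: (linfun_funE (f := fun u => _)) => a s t.
by rewrite formDr formZr scalerDl scalerA.
Qed.

Lemma quadD (char2 : 2%N \in [pchar F]) x y : b (x + y) (x + y) = b x x + b y y.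
Proof. by have two0 : 2 = 0 :> F := pcharf0 char2; rewrite !formE (sym y x); ring: two0. Qed.

Section HyperbolicPlane.
Hypothesis char2 : 2%N \in [pchar F].
Variables (x z : V).
Hypotheses (Qx : b x x = 0) (xz : b x z = 1).

Let two0 : 2 = 0 :> F. Proof. exact: pcharf0. Qed.
Let zx : b z x = 1. Proof. by rewrite sym. Qed.

(* Orthogonal projection along the plane spanned by [x] and [z]. *)
Definition plane_proj : 'End(V) :=
  (\1 + rank1 x z + rank1 z x + b z z *: rank1 x x)%VF.

Lemma plane_projE u : plane_proj u = u + b x u *: z + (b z u + b z z * b x u) *: x.
Proof. by rewrite !(add_lfunE, scale_lfunE, id_lfunE, rank1E) scalerDl scalerA addrA. Qed.

Lemma plane_proj_decomp u :
  u = plane_proj u + b x u *: z + (b z u + b z z * b x u) *: x.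
Proof.
have dd (t : V) : t + t = 0 by rewrite -mulr2n -scaler_nat two0 scale0r.
by rewrite plane_projE -!addrA (addrCA (_ *: x)) dd addr0 dd addr0.
Qed.

Lemma form_x_proj u : b x (plane_proj u) = 0.
Proof. by rewrite plane_projE !formE Qx xz; ring: two0. Qed.

Lemma form_z_proj u : b z (plane_proj u) = 0.
Proof. by rewrite plane_projE !formE zx; ring: two0. Qed.

Lemma plane_proj_perp u : b x u = 0 -> plane_proj u = u + b z u *: x.
Proof. by move=> xu; rewrite plane_projE xu scale0r mulr0 !addr0. Qed.

Lemma plane_proj_id u : b x u = 0 -> b z u = 0 -> plane_proj u = u.
Proof. by move=> xu zu; rewrite plane_proj_perp // zu scale0r addr0. Qed.

Lemma plane_proj_x : plane_proj x = 0.
Proof. by rewrite plane_proj_perp // zx scale1r -mulr2n -scaler_nat two0 scale0r. Qed.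

Lemma plane_projK u : plane_proj (plane_proj u) = plane_proj u.
Proof. by rewrite plane_proj_id ?form_x_proj ?form_z_proj. Qed.

Lemma plane_proj_sym u v : b (plane_proj u) v = b u (plane_proj v).
Proof. by rewrite !plane_projE !formE !(sym u); ring. Qed.

Variable W : {vspace V}.
Hypotheses (ndW : nondeg_on W) (xW : x \in W) (zW : z \in W).

Definition plane_perp : {vspace V} := (W :&: lker (form_hom x) :&: lker (form_hom z))%VS.

Lemma mem_plane_perp u : (u \in plane_perp) = [&& u \in W, b x u == 0 & b z u == 0].
Proof. by rewrite !memv_cap !mem_hyp andbA. Qed.

Lemma plane_perpP u : reflect [/\ u \in W, b x u = 0 & b z u = 0] (u \in plane_perp).
Proof.
by rewrite mem_plane_perp; apply: (iffP and3P) => -[? xu zu]; split=> //; apply/eqP.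
Qed.

Lemma plane_perp_sub : (plane_perp <= W)%VS.
Proof. by apply/subvP=> u /plane_perpP[]. Qed.

Lemma mem_plane_proj u : u \in W -> plane_proj u \in plane_perp.
Proof.
move=> uW; apply/plane_perpP; rewrite form_x_proj form_z_proj; split=> //.
by rewrite plane_projE !memvD ?memvZ.
Qed.

Lemma x_neq0 : x != 0.
Proof. by apply/eqP=> x0; move: xz; rewrite x0 form0l => /esym/eqP; rewrite oner_eq0. Qed.

Lemma dim_plane_perp : \dim W = (\dim plane_perp).+2.
Proof.
apply/eqP; rewrite eqn_leq; apply/andP; split.
  by apply: leq_trans (dim_cap_lker_form _ (form_hom x)) _; rewrite ltnS dim_cap_lker_form.
have zx0 : z \notin <[x]>%VS.
  by apply/vlineP=> -[a za]; move: xz; rewrite za formZr Qx mulr0 => /esym/eqP; rewrite oner_eq0.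
have d2 : \dim (<[x]> + <[z]>) = 2%N by rewrite dim_add_line ?dim_vline ?x_neq0.
have := @dim_orth_le W plane_perp (<[x]> + <[z]>)%VS ndW plane_perp_sub.
rewrite d2 addn2; apply; first by rewrite subv_add -!memvE xW.
move=> u c /plane_perpP[_ xu zu] /memv_addP[_ /vlineP[r ->] [_ /vlineP[t ->] ->]].
by rewrite sym !formE xu zu !mulr0 addr0.
Qed.

Lemma nondeg_plane_perp : nondeg_on plane_perp.
Proof.
move=> u /plane_perpP[uW xu zu] uperp; apply: ndW => // y yW.
by rewrite -[u]plane_proj_id // plane_proj_sym uperp // mem_plane_proj.
Qed.

End HyperbolicPlane.
End SymmetricForm.

(** * Witt index, [SKer Q] and the orthogonal of [Ker Q] *)

Section WittIndex.
Variables (F : fieldType) (V : vectType F) (b : V -> V -> F).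
Hypotheses (bil : pilot_bil_form b) (sym : pilot_sym_form b) (char2 : 2%N \in [pchar F]).

Let two0 : 2 = 0 :> F. Proof. exact: pcharf0. Qed.
Let fE := (formE bil sym).

Definition witt_on (W : {vspace V}) (nu : nat) :=
  (exists X : {vspace V}, [/\ (X <= W)%VS, pilot_totally_singular b X & \dim X = nu]) /\
  (forall X : {vspace V}, (X <= W)%VS -> pilot_totally_singular b X -> (\dim X <= nu)%N).

Lemma totally_singular_add_line (X : {vspace V}) t :
  pilot_totally_singular b X -> b t t = 0 -> (forall s, s \in X -> b t s = 0) ->
  pilot_totally_singular b (X + <[t]>)%VS.
Proof.
move=> tsX Qt tX _ _ /memv_addP[s sX [_ /vlineP[a ->] ->]] /memv_addP[r rX [_ /vlineP[c ->] ->]].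
by rewrite !fE tsX // Qt (sym s) !tX // !mulr0 !addr0.
Qed.

Lemma maximal_singular_absorb W nu (X : {vspace V}) t : witt_on W nu ->
  (X <= W)%VS -> pilot_totally_singular b X -> \dim X = nu ->
  t \in W -> b t t = 0 -> (forall s, s \in X -> b t s = 0) -> t \in X.
Proof.
move=> [_ wmax] XW tsX dX tW Qt tX; apply/negPn/negP => tnX.
have := wmax _ _ (totally_singular_add_line tsX Qt tX).
by rewrite dim_add_line // dX ltnn subv_add XW -memvE => /(_ tW).
Qed.

Lemma witt_dim W nu : nondeg_on b W -> witt_on W nu -> (2 * nu <= \dim W)%N.
Proof.
move=> ndW [[X [XW tsX <-]] _]; rewrite mul2n -addnn.
by apply: (dim_orth_le bil sym ndW) => //; apply: tsX.
Qed.

(** If [Y] is totally singular in the orthogonal of the plane, then so is [Y + <[x]>] in [W], hence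
    the index drops; [X] cut by the orthogonal of [z] shows that it drops by one only. *)
Lemma witt_plane_perp W nu (X : {vspace V}) x z : witt_on W nu ->
  (X <= W)%VS -> pilot_totally_singular b X -> \dim X = nu ->
  x \in X -> b x z = 1 -> witt_on (plane_perp b x z W) nu.-1.
Proof.
move=> [_ wmax] XW tsX dX xX xz.
have w'max (Y : {vspace V}) : (Y <= plane_perp b x z W)%VS ->
    pilot_totally_singular b Y -> (\dim Y < nu)%N.
  move=> YW tsY; have Yperp t : t \in Y -> [/\ t \in W, b x t = 0 & b z t = 0].
    by move/(subvP YW)/plane_perpP; apply.
  have xY : x \notin Y.
    apply/negP=> /Yperp[_ _ zx]; move: xz; rewrite sym zx => /eqP.
    by rewrite eq_sym oner_eq0.
  rewrite -(dim_add_line xY); apply: wmax.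
    rewrite subv_add -memvE (subvP XW) // andbT.
    by apply/subvP=> t /Yperp[].
  by apply: totally_singular_add_line => [||t /Yperp[]] //; apply: tsX.
have X'W : (X :&: lker (form_hom b z) <= plane_perp b x z W)%VS.
  apply/subvP=> t; rewrite memv_cap mem_hyp // => /andP[tX /eqP zt].
  by apply/plane_perpP => //; rewrite tsX // (subvP XW).
have tsX' : pilot_totally_singular b (X :&: lker (form_hom b z)).
  by move=> s t /memv_capP[sX _] /memv_capP[tX _]; apply: tsX.
split; last by move=> Y YW tsY; have := w'max Y YW tsY; lia.
exists (X :&: lker (form_hom b z))%VS; split=> //.
have := dim_cap_lker_form X (form_hom b z); have := w'max _ X'W tsX'.
by rewrite dX; lia.
Qed.

Definition in_SKer (W : {vspace V}) t :=
  [/\ t \in W, b t t = 0 & forall s, s \in W -> b s s = 0 -> b s t = 0].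

Lemma SKer_sub_singular W nu (X : {vspace V}) t : witt_on W nu ->
  (X <= W)%VS -> pilot_totally_singular b X -> \dim X = nu -> in_SKer W t -> t \in X.
Proof.
move=> wW XW tsX dX [tW Qt tker]; apply: (maximal_singular_absorb wW XW tsX dX) => // s sX.
by rewrite sym tker ?tsX // (subvP XW).
Qed.

Lemma kerQ_exists (W : {vspace V}) :
  exists X : {vspace V}, forall t, t \in X <-> (t \in W /\ b t t = 0).
Proof.
apply: vspace_of_pred => [|a s t [sW Qs] [tW Qt]]; first by rewrite mem0v !fE.
by rewrite memvD ?memvZ // quadD // !fE Qs Qt !mulr0 addr0.
Qed.

(* If [SKer Q = 0] then [W] is the orthogonal sum of [Ker Q], on which the form is
   symplectic, and [D = (Ker Q)^perp], on which [Q] has no nontrivial zero. *)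
Lemma trivial_SKer_decomp W nu : nondeg_on b W -> witt_on W nu ->
  (forall t, in_SKer W t -> t = 0) ->
  exists D : {vspace V},
  [/\ (D <= W)%VS,
      forall d t, d \in D -> t \in W -> b t t = 0 -> b d t = 0,
      forall t, t \in W -> (forall d, d \in D -> b d t = 0) -> b t t = 0 &
      \dim W = (2 * nu + \dim D)%N].
Proof.
move=> ndW wW sker0; have [K KP] := kerQ_exists W.
have KW : (K <= W)%VS by apply/subvP=> t /KP[].
pose D := (W :&: orthv b K)%VS.
have DP t : t \in D <-> t \in W /\ forall s, s \in K -> b s t = 0.
  by rewrite memv_cap -(mem_orthv bil sym K t); split=> [/andP|[-> ->]].
have DW : (D <= W)%VS by apply: capvSl.
have DK d t : d \in D -> t \in W -> b t t = 0 -> b d t = 0.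
  by move=> /DP[_ dK] tW Qt; rewrite sym dK //; apply/KP.
have dKD := dim_cap_orthv b W K; rewrite -/D in dKD.
pose E := (W :&: orthv b D)%VS.
have dE : (\dim D + \dim E <= \dim W)%N.
  apply: (dim_orth_le bil sym ndW) => //; first exact: capvSl.
  by move=> d e dD /memv_capP[_ /(mem_orthv bil sym)]; apply.
(* The two dimension inequalities give [\dim E <= \dim K]: [Ker Q] is its own double orthogonal in
   [W]. *)
have EK : K = E.
  apply/eqP; rewrite eqEdim; apply/andP; split; last by lia.
  apply/subvP=> t /KP[tW Qt]; rewrite memv_cap tW /=; apply/(mem_orthv bil sym) => d dD.
  exact: DK.
have perpD t : t \in W -> (forall d, d \in D -> b d t = 0) -> b t t = 0.
  move=> tW tD; suff /KP[] : t \in K by [].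
  by rewrite EK memv_cap tW /=; apply/(mem_orthv bil sym).
exists D; split=> //.
have [[X [XW tsX dX]] _] := wW.
have dXD : \dim (X + D) = (nu + \dim D)%N.
  rewrite dimv_disjoint_sum ?dX //; apply/eqP; rewrite -subv0; apply/subvP=> t.
  rewrite memv0 => /memv_capP[tX tD]; apply/eqP/sker0; split=> [||s sW Qs].
  - exact: (subvP XW).
  - exact: tsX.
  - by rewrite sym DK.
have XDW : (X + D <= W)%VS by rewrite subv_add XW.
have XXD : (\dim X + \dim (X + D) <= \dim W)%N.
  apply: (dim_orth_le bil sym ndW) => // s _ sX /memv_addP[r rX [d dD ->]].
  by rewrite fE (tsX s r) // sym DK ?addr0 ?tsX // (subvP XW).
have := dim_cap_orthv b W (X + D).
(* A vector orthogonal to [X] and [D] is a zero of [Q], hence absorbed by the maximal [X]. *)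
set E2 := (_ :&: _)%VS; have : (\dim E2 <= \dim X)%N.
  apply/dimvS/subvP=> t /memv_capP[tW /(mem_orthv bil sym) tXD].
  apply: (maximal_singular_absorb wW XW tsX dX) => // [|s sX].
    by apply: perpD => // d dD; apply: tXD; rewrite (subvP (addvSr _ _)).
  by rewrite sym tXD // (subvP (addvSl _ _)).
by rewrite dX dXD in XXD *; lia.
Qed.

End WittIndex.

(** * Rank two perturbations of a nilpotent symmetric operator *)

Lemma det_mx22 (R : comNzRingType) (M : 'M[R]_2) :
  \det M = M 0 0 * M 1 1 - M 0 1 * M 1 0.
Proof.
rewrite (expand_det_row _ 0) !big_ord_recl big_ord0 addr0 /cofactor !det_mx11 !mxE /=.
have -> : lift 0 0 = 1 :> 'I_2 by apply: val_inj.
have -> : lift 1 0 = 0 :> 'I_2 by apply: val_inj.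
by rewrite expr0 expr1 mul1r mulN1r mulrN.
Qed.

Section Resolvent.
Variables (F : fieldType) (V : vectType F) (b : V -> V -> F).
Hypotheses (bil : pilot_bil_form b) (sym : pilot_sym_form b) (char2 : 2%N \in [pchar F]).

Let two0 : 2 = 0 :> F. Proof. exact: pcharf0. Qed.
Let fE := (formE bil sym).

Lemma iter_sym (w : 'End(V)) k p q : pilot_b_symmetric b w ->
  b p (iter k w q) = b (iter k w p) q.
Proof.
move=> ws; elim: k p => //= k IH p.
by rewrite ws sym -iterS iterSr -IH sym.
Qed.

Variable N : nat.

(* The matrix coefficient [b p ((1 - s w)^-1 q)], a polynomial in [s] as soon as [w ^ N =
   0]. *)
Definition resolvent (w : 'End(V)) p q : {poly F} := \poly_(k < N) b p (iter k w q).

Lemma coef_resolvent (w : 'End(V)) p q k : (forall y, iter N w y = 0) ->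
  (resolvent w p q)`_k = b p (iter k w q).
Proof.
move=> wN; rewrite coef_poly; case: ltnP => // Nk.
by rewrite (nilp_iter_ge q wN Nk) fE.
Qed.

(** The resolvent identity read coefficient by coefficient, by telescoping. *)
Lemma iter_perturb (w v : 'End(V)) k q :
  iter k (w + v)%R q = iter k w q + \sum_(i < k) iter i w (v (iter (k.-1 - i) (w + v)%R q)).
Proof.
elim: k => [|k IH]; first by rewrite big_ord0 addr0.
rewrite iterS add_lfunE {1}IH linearD /= -addrA; congr (_ + _).
rewrite big_ord_recl /= subn0 addrC; congr (_ + _).
rewrite linear_sum; apply: eq_bigr => i _ /=; congr (w (iter i w (v (iter _ _ q)))).
by rewrite /bump /=; lia.
Qed.

Variables (w v : 'End(V)) (x y : V) (c : F).
Hypotheses (wN : forall t, iter N w t = 0) (uN : forall t, iter N (w + v)%R t = 0).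
Hypothesis vE : forall t, v t = (b y t + c * b x t) *: x + b x t *: y.

Lemma resolvent_perturb p q : resolvent (w + v)%R p q = resolvent w p q +
  'X * (resolvent w p x * (resolvent (w + v)%R y q + c *: resolvent (w + v)%R x q)
        + resolvent w p y * resolvent (w + v)%R x q).
Proof.
apply/polyP=> k; rewrite coefD !coef_resolvent // iter_perturb // fE; congr (_ + _).
rewrite coefXM; case: k => [|k] /=; first by rewrite big_ord0 fE.
rewrite form_sumr // coefD !coefM -big_split /=; apply: eq_bigr => i _.
rewrite vE iter_lfunD !iter_lfunZ !fE coefD coefZ !coef_resolvent //; ring.
Qed.

Let e (i : 'I_2) := if i == 0 then x else y.
Let M u : 'M[{poly F}]_2 := \matrix_(i, j) resolvent u (e i) (e j).
(** [J] is the matrix of [v] in the pair [(x, y)]: [v t] is the sum of the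
    [J i j * b (e j) t *: e i]. *)
Let J : 'M[{poly F}]_2 := \matrix_(i, j) (if i == 0 then if j == 0 then c%:P else 1 else if j == 0 then 1 else 0).

(** The identity says that the determinant of [1 - 'X *: (M w *m J)], which is the quotient of
    [det (1 - s (w + v))] by [det (1 - s w)], equals 1. By the resolvent identity this matrix has a
    polynomial inverse, so its determinant is a unit, hence constant, and its value at 0 is 1. *)
Lemma resolvent_det :
  (1 - 'X * (resolvent w x x * c%:P + resolvent w x y)) * (1 - 'X * resolvent w y x)
  = 1 + 'X * resolvent w x x * ('X * (resolvent w y x * c%:P + resolvent w y y)).
Proof.
have M_perturb : M (w + v)%R = M w + 'X *: (M w *m J *m M (w + v)%R).
  apply/matrixP=> i j; rewrite !mxE !big_ord_recl big_ord0 !mxE !big_ord_recl !big_ord0 !mxE.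
  rewrite resolvent_perturb /e /= -mul_polyC; ring.
have MJ_inv : (1%:M - 'X *: (M w *m J)) *m (1%:M + 'X *: (M (w + v)%R *m J)) = 1%:M.
  rewrite mulmxDl !mulmxDr !mul1mx mulmx1 -scalemxAr mulNmx -scalemxAl !mulmxA.
  rewrite {1}M_perturb mulmxDl -scalemxAl scalerDr scalerN.
  set P := 'X *: (_ *m J); set Q := 'X *: _.
  by rewrite -opprD addrK.
have ord1 : lift 0 0 = 1 :> 'I_2 by apply: val_inj.
have := congr1 determinant MJ_inv; rewrite det_mulmx det1; move: (\det (_ + 'X *: _)) => D'.
set D := \det _ => Dinv.
have DE : D = (1 - 'X * (resolvent w x x * c%:P + resolvent w x y)) * (1 - 'X * resolvent w y x)
    - 'X * resolvent w x x * ('X * (resolvent w y x * c%:P + resolvent w y y)).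
  by rewrite /D det_mx22 !mxE !big_ord_recl !big_ord0 !mxE /e /=; ring.
have : D \is a GRing.unit.
  by apply/unitrP; exists D'; rewrite mulrC Dinv.
rewrite poly_unitE => /andP[/eqP sD _]; have D1 : D = (D`_0)%:P by apply: size1_polyC; rewrite sD.
have D0 : D.[0] = 1 by rewrite DE !hornerE /=; ring.
have D_1 : D = 1 by rewrite D1 -horner_coef0 D0.
by apply/eqP; rewrite -subr_eq -DE D_1.
Qed.

Hypotheses (ws : pilot_b_symmetric b w) (Qx : b x x = 0) (xy : b x y = 0).

(** By symmetry of [w] the linear term in [be] occurs twice in the expanded [resolvent_det] and
    cancels in characteristic 2; a factor ['X] is then divided out. *)
Lemma resolvent_sq :
  'X * resolvent w x y ^+ 2 = 'X * (resolvent w x x * resolvent w y y) + c *: resolvent w x x.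
Proof.
have two0P : 2 = 0 :> {poly F} by rewrite -polyC_natr two0.
have yx : resolvent w y x = resolvent w x y.
  by apply/polyP=> k; rewrite !coef_resolvent // iter_sym // sym.
have X0 : 'X != 0 :> {poly F} by rewrite polyX_eq0.
apply: (mulfI X0); rewrite -mul_polyC.
move: resolvent_det; rewrite yx.
set al := resolvent w x x; set be := resolvent w x y; set ga := resolvent w y y => det1.
transitivity ((1 - 'X * (al * c%:P + be)) * (1 - 'X * be) - 1 + 2 * 'X * be + 'X * al * c%:P - 'X ^+ 2 * al * be * c%:P); first by ring.
by rewrite det1 two0P; ring.
Qed.

(** These are the coefficients of degrees 1, 2 and 3 in [resolvent_sq]; the resolvents at [(x, x)]
    and [(x, y)] have no constant term. *)
Lemma perturb_coef :
  [/\ c * b x (w x) = 0,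
      b x (w x) * b y y + c * b x (iter 2 w x) = 0 &
      b x (w y) ^+ 2 = b x (w x) * b y (w y) + b x (iter 2 w x) * b y y + c * b x (iter 3 w x)].
Proof.
have coef k := congr1 (fun p : {poly F} => p`_k) resolvent_sq.
split.
- have := coef 1%N; rewrite coefD !coefXM coefZ /= expr2 !coefM !big_ord_recl !big_ord0 /=.
  by rewrite !coef_resolvent //= Qx xy !mul0r !add0r.
- have := coef 2%N; rewrite coefD !coefXM coefZ /= expr2 !coefM !big_ord_recl !big_ord0 /=.
  by rewrite !coef_resolvent //= Qx xy !(mul0r, mulr0, add0r, addr0) => <-.
- have := coef 3%N; rewrite coefD !coefXM coefZ /= !expr2 !coefM !big_ord_recl !big_ord0 /=.
  by rewrite !coef_resolvent //= Qx xy !(mul0r, mulr0, add0r, addr0).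
Qed.
End Resolvent.

(** * Splitting off a hyperbolic plane *)

Section Evaluation.
Variables (F : fieldType) (V : vectType F).

Definition ev (t : V) : 'Hom('End(V), V) := linfun (fun u : 'End(V) => u t).
Lemma evE t u : ev t u = u t.
Proof.
by apply: (linfun_funE (f := fun u : 'End(V) => u t)) => a f g; rewrite add_lfunE scale_lfunE.
Qed.

Definition compress (p : 'End(V)) : 'End('End(V)) := linfun (fun u : 'End(V) => p \o u \o p)%VF.
Lemma compressE p u : compress p u = (p \o u \o p)%VF.
Proof.
apply: (linfun_funE (f := fun u : 'End(V) => p \o u \o p)%VF) => a f g.
by apply/lfunP=> t; rewrite !(comp_lfunE, add_lfunE, scale_lfunE) linearP.
Qed.
End Evaluation.

Section NilpotentSymmetric.
Variables (F : fieldType) (V : vectType F) (b : V -> V -> F).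
Hypotheses (bil : pilot_bil_form b) (sym : pilot_sym_form b) (char2 : 2%N \in [pchar F]).
Hypothesis ndV : pilot_nondegenerate b.

Let two0 : 2 = 0 :> F. Proof. exact: pcharf0. Qed.
Let fE := (formE bil sym).

(** Operators on [W] are kept as endomorphisms of [V] with range in [W], so that the ambient space
    is fixed during the induction; by symmetry they vanish on the orthogonal of [W]. *)
Definition nilsym (W : {vspace V}) (A : {vspace 'End(V)}) :=
  forall u, u \in A -> [/\ pilot_nilpotent_endo u, pilot_b_symmetric b u & forall t, u t \in W].

Lemma alternating_symmetric u : pilot_b_alternating b u -> pilot_b_symmetric b u.
Proof.
move=> ua s t; have := ua (s + t); rewrite linearD !fE !ua addr0 add0r => /eqP.
by rewrite addrC addr_eq0 => /eqP->; apply/eqP; rewrite -addr_eq0 -mulr2n -mulr_natl two0 mul0r.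
Qed.

Lemma form_inj s t : (forall u, b u s = b u t) -> s = t.
Proof.
move=> st; apply/eqP; rewrite -subr_eq0; apply/eqP/ndV => u.
by rewrite sym -[- t]scaleN1r !fE st mulN1r subrr.
Qed.

Lemma sym_range_perp0 (W : {vspace V}) (u : 'End(V)) t :
  pilot_b_symmetric b u -> (forall s, u s \in W) -> (forall s, s \in W -> b t s = 0) -> u t = 0.
Proof. by move=> us uW tW; apply: form_inj => s; rewrite us tW ?fE. Qed.

Section Reduction.
Variables (W : {vspace V}) (x z : V).
Hypotheses (ndW : nondeg_on b W) (xW : x \in W) (zW : z \in W).
Hypotheses (Qx : b x x = 0) (xz : b x z = 1).

Let zx : b z x = 1. Proof. by rewrite sym. Qed.
Local Notation p := (plane_proj b x z).
Local Notation W' := (plane_perp b x z W).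

(* The general symmetric endomorphism killing [x] and sending the orthogonal of [x] into
   the line of [x], parametrized by its value [l] at [z]. *)
Definition tau (l : V) : 'End(V) := (rank1 b l x + b z l *: rank1 b x x + rank1 b x l)%VF.

Lemma tauE l t : tau l t = (b l t + b z l * b x t) *: x + b x t *: l.
Proof. by rewrite !(add_lfunE, scale_lfunE, rank1E) // scalerDl scalerA. Qed.

Lemma tau_linear : linear tau.
Proof.
move=> a l k; apply/lfunP=> t; rewrite tauE (add_lfunE (a *: tau l)) (scale_lfunE a) !tauE !fE.
rewrite !scalerDr !scalerA addrACA -scalerDl; congr (_ *: _ + (_ *: _ + _)); ring.
Qed.

Lemma tau_z l : b x l = 0 -> tau l z = l.
Proof.
move=> xl; rewrite tauE xz mulr1 scale1r (sym l) -mulr2n -mulr_natl two0 mul0r.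
by rewrite scale0r add0r.
Qed.

Lemma tau_sym l : pilot_b_symmetric b (tau l).
Proof. by move=> s t; rewrite !tauE !fE !(sym s) !(sym t x) !(sym t l); ring. Qed.

Lemma tau_alt l : b z l = 0 -> pilot_b_alternating b (tau l).
Proof. by move=> zl s; rewrite tauE zl !fE (sym s x) (sym s l); ring: two0. Qed.

Lemma tau_range l t : l \in W -> tau l t \in W.
Proof. by move=> lW; rewrite tauE memvD ?memvZ. Qed.

Section FixedSpace.
Variable A : {vspace 'End(V)}.
Hypothesis nA : nilsym W A.

Definition fixing := (A :&: lker (ev x))%VS.
Definition fiber := (fixing :&: lker (compress p))%VS.
Definition image_x := (ev x @: A)%VS.
(** By [fiber_tau], evaluation at [z] is injective on [fiber]; this copy inside [V] can be paired
    with [image_x]. *)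
Definition fiber_z := (ev z @: fiber)%VS.
Definition reduced := (compress p @: fixing)%VS.

Lemma fixingP u : u \in fixing -> u \in A /\ u x = 0.
Proof. by rewrite memv_cap memv_ker evE => /andP[? /eqP]. Qed.

Lemma fixing_perp u t : u \in fixing -> b x (u t) = 0.
Proof. by case/fixingP=> uA ux; have [_ us _] := nA uA; rewrite us ux fE. Qed.

(** As [p w p = 0] and the range of [w] is orthogonal to [x], [w] sends the range of [p] into the
    line of [x]; it kills [x], and symmetry expresses the remaining coefficient through [w z]. *)
Lemma fiber_tau w : w \in fiber -> w = tau (w z).
Proof.
rewrite memv_cap memv_ker compressE => /andP[w1 /eqP pwp].
have [wA wx] := fixingP w1; have [_ ws _] := nA wA.
apply/lfunP=> t; rewrite tauE.
have wp s : w (p s) = b z (w (p s)) *: x.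
  have := congr1 (fun f : 'End(V) => f s) pwp.
  rewrite !comp_lfunE zero_lfunE plane_proj_perp ?fixing_perp // => /eqP.
  rewrite addr_eq0 => /eqP {1}->; rewrite -scaleNr; congr (_ *: _).
  by apply/eqP; rewrite eq_sym -addr_eq0 -mulr2n -mulr_natl two0 mul0r.
rewrite {1}(plane_proj_decomp bil sym char2 x z t) !linearD !linearZ /= wx scaler0 addr0.
rewrite wp ws sym plane_projE // !fE (sym (w z) x) fixing_perp // mulr0 addr0.
by rewrite (sym (w z) z) [_ * b x t]mulrC.
Qed.

Lemma fiber_zP l : l \in fiber_z -> [/\ tau l \in A, l \in W & b x l = 0].
Proof.
case/memv_imgP=> w wK ->; rewrite evE.
have w1 : w \in fixing by move: wK; rewrite memv_cap => /andP[].
have [wA _] := fixingP w1; have [_ _ wW] := nA wA.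
by rewrite -(fiber_tau wK) wA wW fixing_perp.
Qed.

Lemma dim_reduction : \dim A = (\dim image_x + \dim fiber_z + \dim reduced)%N.
Proof.
rewrite -(limg_ker_dim (ev x) A) -(limg_ker_dim (compress p) fixing) -!/(fixing) -/fiber -/reduced -/image_x.
suff -> : \dim fiber_z = \dim fiber by rewrite [LHS]addnC addnA.
apply: limg_dim_eq; apply/eqP; rewrite -subv0; apply/subvP=> w.
rewrite memv_cap memv_ker evE memv0 => /andP[/fiber_tau wE /eqP wz0].
apply/eqP/lfunP=> t; rewrite wE wz0 tauE !fE mul0r addr0 scale0r scaler0 addr0.
by rewrite zero_lfunE.
Qed.

Lemma reduced_iter u k t : u \in fixing ->
  iter k.+1 (compress p u) t = p (iter k.+1 u (p t)).
Proof.
move=> u1; have [uA ux] := fixingP u1.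
elim: k => [|k IH]; first by rewrite /= compressE !comp_lfunE.
rewrite iterS IH compressE !comp_lfunE plane_projK //; congr (p _).
rewrite [in LHS]/= plane_proj_perp ?fixing_perp //.
by rewrite linearD linearZ /= ux scaler0 addr0.
Qed.

Lemma nilsym_reduced : nilsym W' reduced.
Proof.
move=> _ /memv_imgP[u u1 ->]; have [uA ux] := fixingP u1.
have [[k uk] us uW] := nA uA; split.
- exists k.+1 => t; rewrite reduced_iter // (nilp_iter_ge _ uk) ?linear0 //.
- by move=> s t; rewrite compressE !comp_lfunE -!(plane_proj_sym bil sym) us.
- by move=> t; rewrite compressE !comp_lfunE mem_plane_proj.
Qed.

Lemma alt_reduced : (forall u, u \in A -> pilot_b_alternating b u) ->
  forall u, u \in reduced -> pilot_b_alternating b u.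
Proof.
move=> aA _ /memv_imgP[u /fixingP[uA _] ->] t.
by rewrite compressE !comp_lfunE -(plane_proj_sym bil sym) aA.
Qed.

Lemma x_notin_image : x \notin image_x.
Proof.
apply/negP=> /memv_imgP[u uA]; rewrite evE => ux; have [un _ _] := nA uA.
have x0 : x = 0 by apply: (nilp_fix0 (oner_neq0 F) un); rewrite scale1r.
by move: xz; rewrite x0 fE => /eqP; rewrite eq_sym oner_eq0.
Qed.

Lemma proj_fiber l : l \in fiber_z -> p l = l + b z l *: x.
Proof. by case/fiber_zP=> _ _ xl; rewrite plane_proj_perp. Qed.

Lemma fiber_coef w l : w \in A -> l \in fiber_z ->
  [/\ b z l * b x (w x) = 0,
      b x (w x) * b l l + b z l * b (w x) (w x) = 0 &
      b (w x) (p l) ^+ 2 = b x (w x) * b (p l) (w (p l)) + b (w x) (w x) * b l l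
                           + b z l * b x (iter 3 w x)].
Proof.
move=> wA lL; have [tA lW xl] := fiber_zP lL.
have [[k wk] ws _] := nA wA; have [[j uj] _ _] := nA (memvD wA tA).
have wN t : iter (k + j) w t = 0 by apply: nilp_iter_ge wk _; rewrite leq_addr.
have uN t : iter (k + j) (w + tau l)%R t = 0 by apply: nilp_iter_ge uj _; rewrite leq_addl.
(* Replacing [y] by [y + a *: x] changes [c] by [2 * a = 0], so [p l] can serve as [y] in place of
   [l]. *)
have vE t : tau l t = (b (p l) t + b z l * b x t) *: x + b x t *: p l.
  rewrite tauE proj_fiber // !fE scalerDr scalerA [X in _ = _ + X]addrC addrA -scalerDl; congr (_ *: _ + _).
  have three1 : 3 = 1 :> F by rewrite -[3%N]/(2 + 1)%N natrD two0 add0r.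
  by ring: three1.
have xpl : b x (p l) = 0 by rewrite form_x_proj.
have [] := perturb_coef bil sym char2 wN uN vE ws Qx xpl.
have Qpl : b (p l) (p l) = b l l by rewrite proj_fiber // quadD // !fE Qx !mulr0 addr0.
have Qwx : b x (iter 2 w x) = b (w x) (w x) by rewrite /= ws.
by rewrite Qpl Qwx [b x (w (p l))]ws (sym (p l) (w x)).
Qed.

(** A nilpotent [w] never satisfies [w x = x], so [x] is outside [Y]; being orthogonal to [B] it can
    be added to [Y], whence the strict inequality. *)
Lemma orth_bound (Y B : {vspace V}) : (Y <= image_x)%VS -> (B <= W)%VS ->
  (forall s t, s \in Y -> t \in B -> b s t = 0) -> (forall t, t \in B -> b x t = 0) ->
  (\dim Y + \dim B < \dim W)%N.
Proof.
move=> YA BW YB xB; rewrite -addSn -(dim_add_line (x := x)); last first.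
  by apply: contra x_notin_image; apply: (subvP YA).
apply: (dim_orth_le bil sym ndW) => //.
  rewrite subv_add -memvE xW andbT (subv_trans YA) //.
  by apply/subvP=> _ /memv_imgP[u uA ->]; rewrite evE; have [_ _] := nA uA.
by move=> _ t /memv_addP[s sY [_ /vlineP[a ->] ->]] tB; rewrite !fE YB // xB // mulr0 addr0.
Qed.

(** The vectors [y] of the rank two operators in [fiber], completed by [x]: one dimension more than
    [fiber_z] when [x] is not in [fiber_z]. *)
Definition polar_fiber := (p @: fiber_z + <[x]>)%VS.

Lemma dim_polar_fiber : x \notin fiber_z -> \dim polar_fiber = (\dim fiber_z).+1.
Proof.
move=> xL; rewrite dim_add_line.
  congr _.+1; apply: limg_dim_eq; apply/eqP; rewrite -subv0; apply/subvP=> l.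
  rewrite memv_cap memv_ker memv0 => /andP[lL]; rewrite proj_fiber // addr_eq0 => /eqP lx.
  move: lL; rewrite lx -scaleNr; case: (eqVneq (b z l) 0) => [->|c0].
    by rewrite oppr0 scale0r eqxx.
  by rewrite rpredZeq oppr_eq0 (negPf c0) (negPf xL).
apply/negP=> /memv_imgP[l lL xl]; have := form_z_proj bil sym char2 xz l.
by rewrite -xl zx => /eqP; rewrite oner_eq0.
Qed.

Lemma polar_fiberP t : t \in polar_fiber -> exists2 l, l \in fiber_z & exists a, t = p l + a *: x.
Proof.
by case/memv_addP=> _ /memv_imgP[l lL ->] [_ /vlineP[a ->] ->]; exists l => //; exists a.
Qed.

Lemma polar_fiber_sub : (polar_fiber <= W)%VS.
Proof.
apply/subvP=> _ /polar_fiberP[l /fiber_zP[_ lW _] [a ->]]; rewrite memvD ?memvZ //.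
by have /plane_perpP[] := mem_plane_proj bil sym char2 Qx xz xW zW lW.
Qed.

Lemma polar_fiber_x t : t \in polar_fiber -> b x t = 0.
Proof. by case/polar_fiberP=> l _ [a ->]; rewrite !fE form_x_proj // Qx mulr0 addr0. Qed.

(** Passing to the vectors of [image_x] orthogonal to [h] costs at most one dimension, made up by
    the extra [x] in [polar_fiber]. *)
Lemma hyperplane_bound (h : V) : x \notin fiber_z ->
  (forall w l, w \in A -> l \in fiber_z -> b h (w x) = 0 ->
     b x (w x) = 0 /\ b (w x) (p l) = 0) ->
  (\dim image_x + \dim fiber_z < \dim W)%N.
Proof.
move=> xL H; have := dim_cap_lker_form image_x (form_hom b h).
set Y := (_ :&: _)%VS => dY.
suff : (\dim Y + \dim polar_fiber < \dim W)%N by rewrite dim_polar_fiber //; lia.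
apply: orth_bound; rewrite ?capvSl ?polar_fiber_sub //; last exact: polar_fiber_x.
move=> s t; rewrite memv_cap mem_hyp // => /andP[/memv_imgP[w wA ->]].
rewrite evE => /eqP hw /polar_fiberP[l lL [a ->]].
by have [xw lw] := H w l wA lL hw; rewrite !fE (sym _ x) xw lw mulr0 addr0.
Qed.

Lemma reduction_bound_sym : (\dim image_x + \dim fiber_z < \dim W)%N.
Proof.
have sq0 (a : F) : a ^+ 2 = 0 -> a = 0 by move/eqP; rewrite sqrf_eq0 => /eqP.
(* For [l = x] one has [p l = 0] and [b z l = 1]; the resulting vanishing makes all of [image_x]
   orthogonal to [fiber_z]. *)
have [xL|xL] := boolP (x \in fiber_z).
  have wx0 w : w \in A -> [/\ b x (w x) = 0, b (w x) (w x) = 0 & b x (iter 3 w x) = 0].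
    move=> wA; have := fiber_coef wA xL; rewrite plane_proj_x // zx Qx !mul1r !mulr0 add0r.
    by rewrite !fE mulr0 !add0r expr0n /= => -[-> -> <-].
  apply: orth_bound => //.
  - by apply/subvP=> l /fiber_zP[].
  - move=> _ l /memv_imgP[w wA ->] lL; rewrite evE; have [xw Qw w3] := wx0 w wA.
    have [_ _] := fiber_coef wA lL; rewrite xw Qw w3 !mul0r mulr0 !addr0 => /sq0.
    by rewrite proj_fiber // !fE (sym _ x) xw mulr0 addr0.
  - by move=> l /fiber_zP[].
(* One nonzero [b x (w1 x)] forces [b z l = 0] and [Q l = 0] on the whole of [fiber_z]; the choice
   is then [h = x]. *)
have [[w1 w1A xw1]|nx] := classic (exists2 w, w \in A & b x (w x) <> 0).
  apply: (hyperplane_bound (h := x)) => // w l wA lL xw; split=> //.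
  have [c0 Q0 _] := fiber_coef w1A lL; have [_ _] := fiber_coef wA lL.
  move/eqP: xw1 => xw1; move/eqP: c0; rewrite mulf_eq0 (negPf xw1) orbF => /eqP c0.
  move/eqP: Q0; rewrite c0 mul0r addr0 mulf_eq0 (negPf xw1) => /eqP ->.
  by rewrite xw !mul0r mulr0 !addr0 => /sq0.
have {}nx w : w \in A -> b x (w x) = 0 by move=> wA; apply: NNPP => xw; apply: nx; exists w.
have coef w l : w \in A -> l \in fiber_z -> b z l * b (w x) (w x) = 0 /\
    b (w x) (p l) ^+ 2 = b (w x) (w x) * b l l + b z l * b x (iter 3 w x).
  by move=> wA lL; have [_] := fiber_coef wA lL; rewrite nx // !mul0r !add0r.
(* In each remaining case [b (w x) (p l) ^+ 2] is a single product, of a factor depending on [w] and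
   one depending on [l]. If the latter is nonzero at [l1], orthogonality to [h = p l1] kills the
   former; if it is always zero, [h = 0] will do. *)
have [[w1 w1A Qw1]|nQ] := classic (exists2 w, w \in A & b (w x) (w x) <> 0).
  have c0 l : l \in fiber_z -> b z l = 0.
    by move=> lL; have [/eqP] := coef _ _ w1A lL; rewrite mulf_eq0; move/eqP/negPf: Qw1 => ->; rewrite orbF => /eqP.
  have [[l1 l1L Ql1]|nl] := classic (exists2 l, l \in fiber_z & b l l <> 0).
    apply: (hyperplane_bound (h := p l1)) => // w l wA lL wl1; split; first exact: nx.
    have [_] := coef _ _ wA l1L; rewrite sym wl1 c0 // mul0r addr0 expr0n => /esym/eqP.
    rewrite mulf_eq0; move/eqP/negPf: Ql1 => ->; rewrite orbF => /eqP Qw.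
    by apply: sq0; have [_ ->] := coef _ _ wA lL; rewrite Qw c0 // !mul0r addr0.
  apply: (hyperplane_bound (h := 0)) => // w l wA lL _; split; first exact: nx.
  apply: sq0; have [_ ->] := coef _ _ wA lL; rewrite c0 // mul0r addr0.
  have [->|Ql] := eqVneq (b l l) 0; first by rewrite mulr0.
  by case: nl; exists l => //; apply/eqP.
have {}nQ w : w \in A -> b (w x) (w x) = 0 by move=> wA; apply: NNPP => xw; apply: nQ; exists w.
have [[l1 l1L cl1]|nl] := classic (exists2 l, l \in fiber_z & b z l <> 0).
  apply: (hyperplane_bound (h := p l1)) => // w l wA lL wl1; split; first exact: nx.
  have [_] := coef _ _ wA l1L; rewrite sym wl1 nQ // mul0r add0r expr0n => /esym/eqP.
  rewrite mulf_eq0; move/eqP/negPf: cl1 => -> /= /eqP w3.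
  by apply: sq0; have [_ ->] := coef _ _ wA lL; rewrite w3 nQ // mul0r mulr0 addr0.
apply: (hyperplane_bound (h := 0)) => // w l wA lL _; split; first exact: nx.
apply: sq0; have [_ ->] := coef _ _ wA lL; rewrite nQ // mul0r add0r.
have [->|cl] := eqVneq (b z l) 0; first by rewrite mul0r.
by case: nl; exists l => //; apply/eqP.
Qed.

(** * Sharper reduction bounds for alternating operators *)

Section AlternatingBounds.
Hypothesis aA : forall u, u \in A -> pilot_b_alternating b u.

Lemma alt_fiber l : l \in fiber_z -> b z l = 0 /\ p l = l.
Proof.
move=> lL; have zl : b z l = 0.
  case/memv_imgP: lL => w; rewrite memv_cap => /andP[/fixingP[wA _] _] ->.
  by rewrite evE aA.
by rewrite proj_fiber // zl scale0r addr0.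
Qed.

Lemma alt_coef w l : w \in A -> l \in fiber_z ->
  b (w x) l ^+ 2 = b (w x) (w x) * b l l.
Proof.
move=> wA lL; have [_ _] := fiber_coef wA lL; have [-> ->] := alt_fiber lL.
by rewrite aA // !mul0r add0r addr0.
Qed.

Lemma alt_x_notin_fiber : x \notin fiber_z.
Proof. by apply/negP=> /alt_fiber[]; rewrite zx => /eqP; rewrite oner_eq0. Qed.

(** All of [image_x] is orthogonal to [polar_fiber], so no hyperplane is cut out and one dimension
    is gained over [hyperplane_bound]. *)
Lemma alt_isotropic_bound :
  (forall w l, w \in A -> l \in fiber_z -> b (w x) (w x) * b l l = 0) ->
  ((\dim image_x + \dim fiber_z).+1 < \dim W)%N.
Proof.
move=> H; rewrite -addnS -(dim_polar_fiber alt_x_notin_fiber).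
apply: orth_bound; rewrite ?polar_fiber_sub //; last exact: polar_fiber_x.
move=> _ _ /memv_imgP[w wA ->] /polar_fiberP[l lL [a ->]]; rewrite evE.
have [_ ->] := alt_fiber lL; rewrite !fE (sym _ x) aA // mulr0 addr0.
by apply/eqP; rewrite -sqrf_eq0 alt_coef // H.
Qed.

(* If [j >= 1] is maximal with [Q (w ^ j x) != 0], then [w ^ (2j) x] lies in [Ker Q] but
   is not orthogonal to [x]. *)
Lemma SKer_orbit_isotropic w : in_SKer b W x -> w \in A -> b (w x) (w x) = 0.
Proof.
case=> _ _ xker wA; have [[N wN] ws wW] := nA wA.
have itW j : iter j w x \in W by case: j => //= j.
suff H d j : (0 < j)%N -> (N <= d + j)%N -> b (iter j w x) (iter j w x) = 0.
  by apply: (H N 1%N) => //; rewrite leq_addr.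
elim: d j => [|d IH] j j0 Nj; first by rewrite (nilp_iter_ge x wN Nj) fE.
rewrite -iter_sym // -iterD sym xker //.
by apply: IH; lia.
Qed.

Lemma reduction_bound_SKer : in_SKer b W x -> ((\dim image_x + \dim fiber_z).+1 < \dim W)%N.
Proof.
by move=> xs; apply: alt_isotropic_bound => w l wA _; rewrite SKer_orbit_isotropic // mul0r.
Qed.

(** If [Q (w1 x) * Q l1] is nonzero, restricting to the orthogonal of [l1] costs one dimension of
    [image_x], but [Q] vanishes on what is left. A vector [d] of [D] outside [polar_fiber] is
    orthogonal to it and recovers the loss. *)
Lemma reduction_bound_alt nu : witt_on b W nu -> (forall t, in_SKer b W t -> t = 0) ->
  \dim W <> (2 * nu + 1)%N -> ((\dim image_x + \dim fiber_z).+1 < \dim W)%N.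
Proof.
move=> wW sker0 dW.
have [H|/not_all_ex_not[w1 /not_all_ex_not[l1 H]]] :=
  classic (forall w l, w \in A -> l \in fiber_z -> b (w x) (w x) * b l l = 0).
  exact: alt_isotropic_bound.
have [w1A H1] := imply_to_and _ _ H; have [l1L /eqP Q1] := imply_to_and _ _ H1.
move: Q1; rewrite mulf_eq0 => /norP[Qw1 Ql1].
have [D [DW DK KD dimW]] := trivial_SKer_decomp bil sym char2 ndW wW sker0.
have wxW w : w \in A -> w x \in W by move=> wA; have [_ _] := nA wA.
have [DL|/subvPn[d dD dnL]] := boolP (D <= polar_fiber)%VS.
  (* In [polar_fiber], orthogonality to [w1 x] implies [Q = 0], so [D] meets the orthogonal of
     [w1 x] inside [SKer Q]. Hence [\dim D <= 1], then [D = 0] by the dimension hypothesis, and [Q]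
     would vanish on [W]. *)
  have D1 : (D :&: lker (form_hom b (w1 x)) = 0)%VS.
    apply/eqP; rewrite -subv0; apply/subvP=> d /memv_capP[dD]; rewrite memv0 mem_hyp //.
    move=> /eqP w1d; apply/eqP/sker0; have Qd : b d d = 0.
      have /polar_fiberP[l lL [a dE]] := subvP DL d dD; move: w1d.
      rewrite dE quadD // !fE Qx !mulr0 addr0 (sym _ x) aA // mulr0 addr0.
      have [_ ->] := alt_fiber lL => w1l; have := alt_coef w1A lL.
      rewrite w1l expr0n => /esym/eqP.
      by rewrite mulf_eq0 (negPf Qw1) => /eqP.
    by split=> [||s sW Qs] //; [apply: (subvP DW)|rewrite sym DK].
  have := dim_cap_lker_form D (form_hom b (w1 x)); rewrite D1 dimv0 => dD.
  have /eqP : \dim D = 0%N by lia.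
  rewrite dimv_eq0 => /eqP D0; case/eqP: Ql1; apply: KD; first by case/fiber_zP: l1L.
  by move=> d; rewrite D0 memv0 => /eqP ->; rewrite fE.
have := dim_cap_lker_form image_x (form_hom b l1).
set Y := (_ :&: _)%VS => dY.
suff : (\dim Y + \dim (polar_fiber + <[d]>) < \dim W)%N.
  by rewrite dim_add_line // dim_polar_fiber ?alt_x_notin_fiber //; lia.
apply: orth_bound; rewrite ?capvSl //.
- by rewrite subv_add polar_fiber_sub -memvE (subvP DW).
- move=> s t /memv_capP[/memv_imgP[w wA ->]]; rewrite evE mem_hyp // => /eqP l1w.
  have Qw : b (w x) (w x) = 0.
    have := alt_coef wA l1L; rewrite sym l1w expr0n => /esym/eqP.
    by rewrite mulf_eq0 (negPf Ql1) orbF => /eqP.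
  move=> /memv_addP[_ /polar_fiberP[l lL [a ->]] [_ /vlineP[c ->] ->]].
  have [_ ->] := alt_fiber lL; rewrite !fE (sym _ x) aA // (sym _ d).
  have -> : b (w x) l = 0 by apply/eqP; rewrite -sqrf_eq0 alt_coef // Qw mul0r.
  by rewrite (DK d (w x)) ?wxW // !mulr0 !addr0.
- move=> t /memv_addP[s sL [_ /vlineP[c ->] ->]].
  by rewrite !fE polar_fiber_x // (sym x) DK // mulr0 addr0.
Qed.

End AlternatingBounds.
End FixedSpace.

(** * Extension of nilpotent spaces from [W'] to [W] *)

Lemma plane_perp_range0 u : pilot_b_symmetric b u -> (forall t, u t \in W') -> u x = 0 /\ u z = 0.
Proof.
move=> us uW; split; apply: sym_range_perp0 us uW _ => s.
  by case/plane_perpP.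
by case/plane_perpP.
Qed.

Lemma extension_nilpotent u l : pilot_nilpotent_endo u -> pilot_b_symmetric b u ->
  (forall t, u t \in W') -> b x l = 0 -> pilot_nilpotent_endo (u + tau l)%R.
Proof.
move=> [N uN] us uW xl; set v := (u + tau l)%R; have [ux uz] := plane_perp_range0 us uW.
have xu t : b x (u t) = 0 by have /plane_perpP[] := uW t.
have vE t : v t = u t + tau l t by rewrite add_lfunE.
have vx : v x = 0.
  by rewrite vE ux tauE Qx (sym l) xl mulr0 !addr0 !scale0r ?addr0.
have xv t : b x (v t) = 0 by rewrite vE fE xu add0r (tau_sym l) tauE Qx (sym l) xl mulr0 !addr0 !scale0r ?addr0 fE.
have it k t : b x t = 0 -> exists a, iter k v t = iter k u t + a *: x.
  move=> xt; have xit j : b x (iter j u t) = 0 by case: j => [|j] //=.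
  elim: k => [|k [a IH]]; first by exists 0; rewrite scale0r addr0.
  exists (b l (iter k u t)); rewrite !iterS IH linearD linearZ /= vx scaler0 addr0 vE.
  by rewrite tauE xit mulr0 scale0r !addr0.
(* One iteration enters the orthogonal of [x], [N] more reach the line of [x], the last one kills
   it. *)
exists N.+2 => t; rewrite iterS iterSr; have [a ->] := it N _ (xv t).
by rewrite uN add0r linearZ /= vx scaler0.
Qed.

(** [A'] is completed by the operators [tau l]; the sum is direct because [A'] kills [z] while
    [tau l z = l]. *)
Lemma reduction_extend (A' : {vspace 'End(V)}) (U : {vspace V}) :
  nilsym W' A' -> (forall l, l \in U -> l \in W /\ b x l = 0) ->
  exists A : {vspace 'End(V)}, [/\ nilsym W A, \dim A = (\dim A' + \dim U)%N &
    (forall u, u \in A' -> pilot_b_alternating b u) -> (forall l, l \in U -> b z l = 0) ->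
     forall u, u \in A -> pilot_b_alternating b u].
Proof.
move=> nA' UW; pose tauh : 'Hom(V, 'End(V)) := linfun tau.
have tauhE l : tauh l = tau l by apply: linfun_funE; apply: tau_linear.
have mem u : u \in (A' + tauh @: U)%VS -> exists u' l, [/\ u' \in A', l \in U & u = (u' + tau l)%R].
  by case/memv_addP=> u' u'A [_ /memv_imgP[l lU ->] ->]; exists u', l; rewrite tauhE.
have tau0 : tau 0 = 0.
  by apply/lfunP=> t; rewrite tauE !fE mul0r addr0 scale0r scaler0 addr0 zero_lfunE.
exists (A' + tauh @: U)%VS; split.
- move=> _ /mem[u' [l [u'A lU ->]]]; have [u'n u's u'W] := nA' u' u'A.
  have [lW xl] := UW l lU; split; first exact: extension_nilpotent.
    by move=> s t; rewrite !(add_lfunE u') !fE u's (tau_sym l).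
  by move=> t; rewrite (add_lfunE u') memvD ?tau_range //; have /plane_perpP[] := u'W t.
- rewrite dimv_disjoint_sum.
    congr (_ + _)%N; apply: limg_dim_eq; apply/eqP; rewrite -subv0; apply/subvP=> l.
    rewrite memv0 => /memv_capP[lU]; rewrite memv_ker tauhE => /eqP tl.
    by have [_ /tau_z] := UW l lU; rewrite tl zero_lfunE => <-.
  apply/eqP; rewrite -subv0; apply/subvP=> u /memv_capP[uA /memv_imgP[l lU]].
  rewrite tauhE => uE; have [_ us uW] := nA' u uA; have [_ /tau_z tl] := UW l lU.
  have [_ uz] := plane_perp_range0 us uW; move: tl; rewrite -uE uz => l0.
  by rewrite memv0 uE -l0 tau0.
- move=> aA' zU _ /mem[u' [l [u'A lU ->]]] t.
  by rewrite (add_lfunE u') fE aA' // add0r tau_alt // zU.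
Qed.

(** Since [x] is in [SKer Q], a zero of [Q] in [W] is orthogonal to [x] and differs from its
    projection to [W'] by a multiple of [x]. *)
Lemma SKer_plane_perp t : in_SKer b W x ->
  in_SKer b W' t <-> in_SKer b W t /\ b z t = 0.
Proof.
move=> [_ _ xker]; split=> [[/(plane_perpP bil sym)[tW xt zt] Qt tker]|[[tW Qt tker] zt]].
  split=> //; split=> // s sW Qs; have xs : b x s = 0 by rewrite sym xker.
  have ps : p s = s + b z s *: x by rewrite plane_proj_perp.
  have := tker (p s) (mem_plane_proj bil sym char2 Qx xz xW zW sW).
  by rewrite ps quadD // !fE Qx xt !mulr0 !addr0 => ->.
split=> //; first by apply/(plane_perpP bil sym); split=> //; apply: tker.
by move=> s /(plane_perpP bil sym)[sW _ _]; apply: tker.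
Qed.

End Reduction.
End NilpotentSymmetric.

(** * Upper bounds *)

Section GreatestDimensions.
Variables (F : fieldType) (V : vectType F) (b : V -> V -> F).
Hypotheses (bil : pilot_bil_form b) (sym : pilot_sym_form b) (char2 : 2%N \in [pchar F]).
Hypothesis ndV : pilot_nondegenerate b.

Let fE := (formE bil sym).
Implicit Types (W X K : {vspace V}) (A : {vspace 'End(V)}).

Lemma dual_vector W x : nondeg_on b W -> x \in W -> x != 0 ->
  exists2 z, z \in W & b x z = 1.
Proof.
move=> ndW xW x0; apply: NNPP => H; case/eqP: x0; apply: ndW => // y yW.
apply: NNPP => /eqP xy; apply: H; exists ((b x y)^-1 *: y); first exact: memvZ.
by rewrite fE mulVf.
Qed.

Lemma witt_singular_vector W nu : witt_on b W nu.+1 ->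
  exists X x, [/\ (X <= W)%VS, pilot_totally_singular b X, \dim X = nu.+1, x \in X & x != 0].
Proof.
case=> [[X [XW tsX dX]] _]; exists X, (vpick X); split=> //; first exact: memv_pick.
by rewrite vpick0 -dimv_eq0 dX.
Qed.

Lemma witt_singular_line W nu X x : witt_on b W nu.+1 -> nondeg_on b W ->
  (X <= W)%VS -> pilot_totally_singular b X -> \dim X = nu.+1 -> x \in X -> x != 0 ->
  exists z, [/\ x \in W, z \in W, b x x = 0, b x z = 1 &
   [/\ nondeg_on b (plane_perp b x z W), witt_on b (plane_perp b x z W) nu &
    \dim W = (\dim (plane_perp b x z W)).+2]].
Proof.
move=> wW ndW XW tsX dX xX x0; have xW := subvP XW x xX.
have [z zW xz] := dual_vector ndW xW x0; have Qx : b x x = 0 by apply: tsX.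
exists z; split=> //; split.
- exact: (nondeg_plane_perp bil sym char2).
- exact: (witt_plane_perp bil sym char2 wW XW tsX dX xX xz).
- exact: (dim_plane_perp bil sym).
Qed.

(** If [u t] is nonzero, the last nonzero iterate [s] of [t] lies in [W], and symmetry turns [Q s]
    into [b t (u ^ (2 k + 2) t) = 0], which Witt index 0 excludes. *)
Lemma nilsym_anisotropic W A : witt_on b W 0 -> nilsym b W A -> A = 0%VS.
Proof.
move=> [_ w0] nA; apply/eqP; rewrite -subv0; apply/subvP=> u uA; rewrite memv0.
have [[N uN] us uW] := nA u uA; apply/eqP/lfunP=> t; rewrite zero_lfunE.
apply/eqP/negPn/negP=> ut.
have exk : exists k, iter k u t == 0 by exists N; rewrite uN.
case: (ex_minnP exk) => k /eqP uk kmin.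
case: k uk kmin => [|[|k]] uk kmin; first by move: ut; rewrite (uk : t = 0) linear0 eqxx.
  by move: ut; rewrite (uk : u t = 0) eqxx.
pose s := iter k.+1 u t.
have s0 : s != 0 by apply/negP=> /kmin; rewrite ltnn.
have Qs : b s s = 0.
  rewrite /s -iter_sym // -iterD (_ : k.+1 + k.+1 = k + k.+2)%N; last by lia.
  by rewrite iterD uk iter_lfun0 fE.
have : (\dim <[s]> <= 0)%N.
  apply: w0; first by rewrite -memvE /s iterS.
  by move=> _ _ /vlineP[a ->] /vlineP[c ->]; rewrite !fE Qs !mulr0.
by rewrite dim_vline s0.
Qed.

Lemma dim_nilsym_le nu W A : nondeg_on b W -> witt_on b W nu -> nilsym b W A ->
  (\dim A <= nu * (\dim W - nu))%N.
Proof.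
elim: nu W A => [|nu IH] W A ndW wW nA; first by rewrite (nilsym_anisotropic wW nA) dimv0.
have [X [x [XW tsX dX xX x0]]] := witt_singular_vector wW.
have [z [xW zW Qx xz [nd' w' dW]]] := witt_singular_line wW ndW XW tsX dX xX x0.
have := reduction_bound_sym bil sym char2 ndW xW zW Qx xz nA.
have := IH _ _ nd' w' (nilsym_reduced bil sym char2 xW zW Qx xz nA).
rewrite (dim_reduction bil sym char2 x z nA).
have := witt_dim bil sym nd' w'; rewrite dW.
set m := \dim (plane_perp _ _ _ _) => d1 d2 d3.
(* Writing [m = 2 * nu + e] turns the truncated subtractions into sums; the bound grows by
   [\dim W - 1] at each step. *)
have [e me] : exists e, m = (2 * nu + e)%N by exists (m - 2 * nu)%N; lia.
move: d2 d3; rewrite me (_ : 2 * nu + e - nu = nu + e)%N; last by lia.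
rewrite (_ : (2 * nu + e).+2 - nu.+1 = nu + e + 1)%N; last by lia.
move: (\dim (reduced _ _ _ _)) (\dim (image_x _ _)) (\dim (fiber_z _ _ _ _)) => r i f; clear; nia.
Qed.

Definition nilalt W A := nilsym b W A /\ forall u, u \in A -> pilot_b_alternating b u.

Lemma SKer_singular_vector W nu t : witt_on b W nu -> in_SKer b W t -> t != 0 ->
  exists X, [/\ (X <= W)%VS, pilot_totally_singular b X, \dim X = nu, t \in X & (0 < nu)%N].
Proof.
move=> wW ts t0; have [[X [XW tsX dX]] _] := wW.
have tX := SKer_sub_singular bil sym wW XW tsX dX ts; exists X; split=> //.
rewrite -dX lt0n dimv_eq0; apply/negP=> /eqP X0; move: tX.
by rewrite X0 memv0 (negPf t0).
Qed.

Lemma dim_nilalt_le nu W A : nondeg_on b W -> witt_on b W nu -> nilalt W A ->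
  \dim W <> (2 * nu + 1)%N -> (\dim A <= nu * (\dim W - nu - 1))%N.
Proof.
elim: nu W A => [|nu IH] W A ndW wW [nA aA] dWn; first by rewrite (nilsym_anisotropic wW nA) dimv0.
(* A vector of [SKer Q] is taken for [x] if there is one; otherwise the dimension hypothesis serves,
   which passes to [W'] since [\dim W] and [2 * nu] both drop by 2. *)
have [X [x [XW tsX dX [xX x0] bnd]]] : exists X x,
    [/\ (X <= W)%VS, pilot_totally_singular b X, \dim X = nu.+1, x \in X /\ x != 0 &
        forall z, x \in W -> z \in W -> b x x = 0 -> b x z = 1 ->
          ((\dim (image_x x A) + \dim (fiber_z b x z A)).+1 < \dim W)%N].
  have [[t ts /eqP t0]|nt] := classic (exists2 t, in_SKer b W t & t <> 0).
    have [X [XW tsX dX tX _]] := SKer_singular_vector wW ts t0.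
    exists X, t; split=> // z tW zW Qt tz.
    exact: (reduction_bound_SKer bil sym char2 ndW tW zW Qt tz nA aA).
  have [X [x [XW tsX dX xX x0]]] := witt_singular_vector wW.
  exists X, x; split=> // z xW zW Qx xz.
  apply: (reduction_bound_alt bil sym char2 ndW xW zW Qx xz nA aA wW) => // t ts.
  by apply: NNPP => t0; apply: nt; exists t.
have [z [xW zW Qx xz [nd' w' dW]]] := witt_singular_line wW ndW XW tsX dX xX x0.
have nA' : nilalt (plane_perp b x z W) (reduced b x z A).
  split; first exact: (nilsym_reduced bil sym char2 xW zW Qx xz nA).
  exact: (alt_reduced bil sym aA).
have := IH _ _ nd' w' nA'; have := bnd z xW zW Qx xz.
rewrite (dim_reduction bil sym char2 x z nA).
have := witt_dim bil sym nd' w'; rewrite dW in dWn *.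
move: dWn; set m := \dim (plane_perp _ _ _ _) => dWn d1 d2 d3.
have [e me] : exists e, m = (2 * nu + e)%N by exists (m - 2 * nu)%N; lia.
have {}d3 := d3 ltac:(lia).
move: d2 d3; rewrite me (_ : (2 * nu + e).+2 - nu.+1 - 1 = nu + e)%N; last by lia.
move: (\dim (reduced _ _ _ _)) (\dim (image_x _ _)) (\dim (fiber_z _ _ _ _)) => r i f; clear.
case: nu => [|k]; first by lia.
by rewrite (_ : 2 * k.+1 + e - k.+1 - 1 = k + e)%N; [nia|lia].
Qed.

Lemma SKer_cap_plane W K x z : (forall t, t \in K -> in_SKer b W t) ->
  x \in K -> x \in W -> z \in W -> b x x = 0 -> b x z = 1 ->
  \dim K = (\dim (K :&: lker (form_hom b z))).+1 /\
  forall t, t \in (K :&: lker (form_hom b z))%VS -> in_SKer b (plane_perp b x z W) t.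
Proof.
move=> KS xK xW zW Qx xz; split.
  apply/eqP; rewrite eqn_leq dim_cap_lker_form -(dim_add_line (x := x)).
    by rewrite dimvS // subv_add capvSl -memvE.
  by rewrite memv_cap xK mem_hyp // sym xz oner_eq0.
move=> t /memv_capP[tK]; rewrite mem_hyp // => /eqP zt.
by apply/(SKer_plane_perp bil sym char2 xW zW Qx xz t (KS _ xK)); split=> //; apply: KS.
Qed.

(** When [x] is in [K], the reduction bound improves by one while [\dim K] drops by one; when
    [K = 0] the symmetric bound suffices. Letting [K] be any subspace of [SKer Q] allows [K = 0] to
    be kept from then on. *)
Lemma dim_nilalt_le_odd nu W A K : nondeg_on b W -> witt_on b W nu -> nilalt W A ->
  \dim W = (2 * nu + 1)%N -> (forall t, t \in K -> in_SKer b W t) ->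
  (\dim A + \dim K <= nu * (\dim W - nu))%N.
Proof.
elim: nu W A K => [|nu IH] W A K ndW wW [nA aA] dWn KS.
  rewrite (nilsym_anisotropic wW nA) dimv0 mul0n add0n.
  have [_ w0] := wW; apply: w0; first by apply/subvP=> t /KS[].
  by move=> s t /KS[sW Qs _] /KS[_ _ tker]; apply: tker.
have [X [x [XW tsX dX [xX x0] Kx]]] : exists X x,
    [/\ (X <= W)%VS, pilot_totally_singular b X, \dim X = nu.+1, x \in X /\ x != 0 &
        x \in K \/ K = 0%VS].
  have [K0|K0] := eqVneq K 0%VS.
    have [X [x [XW tsX dX xX x0]]] := witt_singular_vector wW.
    by exists X, x; split=> //; right.
  have t0 : vpick K != 0 by rewrite vpick0.
  have [X [XW tsX dX tX _]] := SKer_singular_vector wW (KS _ (memv_pick K)) t0.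
  by exists X, (vpick K); split=> //; left; apply: memv_pick.
have [z [xW zW Qx xz [nd' w' dW]]] := witt_singular_line wW ndW XW tsX dX xX x0.
have nA' : nilalt (plane_perp b x z W) (reduced b x z A).
  split; first exact: (nilsym_reduced bil sym char2 xW zW Qx xz nA).
  exact: (alt_reduced bil sym aA).
have dW' : \dim (plane_perp b x z W) = (2 * nu + 1)%N by lia.
have arith a c : (a + c <= nu * (2 * nu + 1 - nu) + (2 * nu + 2) -> a + c <= nu.+1 * (2 * nu.+1 + 1 - nu.+1))%N.
  rewrite (_ : 2 * nu + 1 - nu = nu + 1)%N; last by lia.
  by rewrite (_ : 2 * nu.+1 + 1 - nu.+1 = nu + 2)%N; [nia|lia].
rewrite (dim_reduction bil sym char2 x z nA) dWn; apply: arith.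
case: Kx => [xK|K0].
  have [dK K'S] := SKer_cap_plane KS xK xW zW Qx xz.
  have := reduction_bound_SKer bil sym char2 ndW xW zW Qx xz nA aA (KS _ xK).
  have := IH _ _ _ nd' w' nA' dW' K'S; rewrite dW' dWn dK.
  move: (\dim (_ :&: _)) => k; move: (\dim (reduced _ _ _ _)) (\dim (image_x _ _)) (\dim (fiber_z _ _ _ _)) => r i f; clear; lia.
have := reduction_bound_sym bil sym char2 ndW xW zW Qx xz nA.
have : (\dim (reduced b x z A) + \dim (0%VS : {vspace V}) <= nu * (2 * nu + 1 - nu))%N.
  rewrite -dW'; apply: IH => // t; rewrite memv0 => /eqP ->.
  by split; rewrite ?mem0v ?fE // => s _ _; rewrite fE.
rewrite K0 dimv0 dWn.
move: (\dim (reduced _ _ _ _)) (\dim (image_x _ _)) (\dim (fiber_z _ _ _ _)) => r i f; clear; lia.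
Qed.

End GreatestDimensions.

(** * Constructions *)

Section Constructions.
Variables (F : fieldType) (V : vectType F) (b : V -> V -> F).
Hypotheses (bil : pilot_bil_form b) (sym : pilot_sym_form b) (char2 : 2%N \in [pchar F]).
Hypothesis ndV : pilot_nondegenerate b.

Let two0 : 2 = 0 :> F. Proof. exact: pcharf0. Qed.
Let fE := (formE bil sym).
Implicit Types (W X K : {vspace V}) (A : {vspace 'End(V)}).

Lemma nilsym0 W : nilsym b W 0%VS.
Proof.
move=> u; rewrite memv0 => /eqP ->; split; last by move=> t; rewrite zero_lfunE mem0v.
  by exists 1%N => t /=; rewrite zero_lfunE.
by move=> s t; rewrite !zero_lfunE !fE.
Qed.

Lemma nilalt0 W : nilalt b W 0%VS.
Proof.
split; first exact: nilsym0.
by move=> u; rewrite memv0 => /eqP -> t; rewrite zero_lfunE fE.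
Qed.

Lemma nilsym_exists nu W : nondeg_on b W -> witt_on b W nu ->
  exists A, nilsym b W A /\ \dim A = (nu * (\dim W - nu))%N.
Proof.
elim: nu W => [|nu IH] W ndW wW.
  by exists 0%VS; rewrite dimv0; split=> //; apply: nilsym0.
have [X [x [XW tsX dX xX x0]]] := witt_singular_vector wW.
have [z [xW zW Qx xz [nd' w' dW]]] := witt_singular_line bil sym char2 wW ndW XW tsX dX xX x0.
have [A' [nA' dA']] := IH _ nd' w'.
have UW l : l \in (plane_perp b x z W + <[x]>)%VS -> l \in W /\ b x l = 0.
  move=> /memv_addP[s /(plane_perpP bil sym)[sW xs _] [_ /vlineP[a ->] ->]].
  by rewrite memvD ?memvZ // !fE xs Qx mulr0 addr0.
have [A [nA dA _]] := reduction_extend bil sym char2 ndV xW Qx xz nA' UW.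
exists A; split=> //; rewrite dA dim_add_line; last first.
  apply/negP=> /(plane_perpP bil sym)[_ _]; rewrite sym xz => /eqP; by rewrite oner_eq0.
have := witt_dim bil sym nd' w'; rewrite dA' dW.
move: (\dim (plane_perp _ _ _ _)) => m d1.
have [e ->] : exists e, m = (2 * nu + e)%N by exists (m - 2 * nu)%N; lia.
rewrite (_ : 2 * nu + e - nu = nu + e)%N; last by lia.
rewrite (_ : (2 * nu + e).+2 - nu.+1 = nu + e + 1)%N; last by lia.
clear; nia.
Qed.

(** Alternation asks for [b z l = 0], so the values at [z] range over the orthogonal of the plane,
    without the line of [x] used in [nilsym_exists]. *)
Lemma nilalt_extend nu W X x A' : nondeg_on b W -> witt_on b W nu.+1 ->
  (X <= W)%VS -> pilot_totally_singular b X -> \dim X = nu.+1 -> x \in X ->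
  forall z, z \in W -> b x z = 1 -> nilalt b (plane_perp b x z W) A' ->
  exists A, nilalt b W A /\ \dim A = (\dim A' + \dim (plane_perp b x z W))%N.
Proof.
move=> ndW wW XW tsX dX xX z zW xz [nA' aA'].
have Qx : b x x = 0 by apply: tsX.
have UW l : l \in plane_perp b x z W -> l \in W /\ b x l = 0.
  by case/(plane_perpP bil sym).
have [A [nA dA aA]] := reduction_extend bil sym char2 ndV (subvP XW x xX) Qx xz nA' UW.
by exists A; split=> //; split=> //; apply: aA => // l /(plane_perpP bil sym)[].
Qed.

Lemma nilalt_exists nu W : nondeg_on b W -> witt_on b W nu ->
  exists A, nilalt b W A /\ \dim A = (nu * (\dim W - nu - 1))%N.
Proof.
elim: nu W => [|nu IH] W ndW wW.
  by exists 0%VS; rewrite dimv0; split=> //; apply: nilalt0.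
have [X [x [XW tsX dX xX x0]]] := witt_singular_vector wW.
have [z [xW zW Qx xz [nd' w' dW]]] := witt_singular_line bil sym char2 wW ndW XW tsX dX xX x0.
have [A' [nA' dA']] := IH _ nd' w'.
have [A [nA dA]] := nilalt_extend ndW wW XW tsX dX xX zW xz nA'.
exists A; split=> //; rewrite dA dA' dW.
have := witt_dim bil sym nd' w'.
move: (\dim (plane_perp _ _ _ _)) => m d1.
have [e ->] : exists e, m = (2 * nu + e)%N by exists (m - 2 * nu)%N; lia.
clear; case: nu => [|k]; first by lia.
rewrite (_ : 2 * k.+1 + e - k.+1 - 1 = k + e)%N; last by lia.
rewrite (_ : (2 * k.+1 + e).+2 - k.+2 - 1 = k + e + 1)%N; last by lia.
nia.
Qed.

Section AnisotropicLine.
Variables (W H : {vspace V}) (d : V).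
Hypotheses (dW : d \in W) (HW : (H <= W)%VS) (Qd : b d d != 0).
Hypotheses (Hd : forall h, h \in H -> b d h = 0) (QH : forall h, h \in H -> b h h = 0).
Hypothesis WH : forall t, t \in W -> exists h a, h \in H /\ t = h + a *: d.
Variable A : {vspace 'End(V)}.
Hypothesis nA : nilalt b H A.

Definition delta (y : V) : 'End(V) := (rank1 b d y + rank1 b y d)%VF.

Lemma deltaE y t : delta y t = b d t *: y + b y t *: d.
Proof. by rewrite !(add_lfunE, rank1E). Qed.

Lemma delta_linear : linear delta.
Proof.
move=> a y s; apply/lfunP=> t; rewrite deltaE (add_lfunE (a *: delta y)) (scale_lfunE a) !deltaE.
by rewrite !fE !scalerDr !scalerA scalerDl addrACA (mulrC (b d t)).
Qed.

Lemma delta_alt y : pilot_b_alternating b (delta y).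
Proof. by move=> t; rewrite deltaE !fE (sym t y) (sym t d); ring: two0. Qed.

(** The orbit of [y] is the same under [v] and [u], since [b y (u ^ k y) = 0]. So [v] is nilpotent
    on [d], whose image is a multiple of [y], and on [H] it agrees with [u] modulo [d]. *)
Lemma delta_nilpotent u y : u \in A -> y \in H -> pilot_nilpotent_endo (u + delta y)%R.
Proof.
move=> uA yH; have [nA' aA] := nA; have [[N uN] us uH] := nA' u uA.
set v := (u + delta y)%R.
have vE t : v t = u t + (b d t *: y + b y t *: d) by rewrite (add_lfunE u) deltaE.
have ud : u d = 0 by apply: (sym_range_perp0 bil sym ndV us uH).
have uitH k t : t \in H -> iter k u t \in H by case: k => [|k] //=.
(* With [s = u ^ (k / 2) y], this is [b s s] or [b s (u s)] according to the parity of [k]. *)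
have orbit k : b y (iter k u y) = 0.
  rewrite -(odd_double_half k) addnC -addnn -addnA iterD iter_sym // addnC.
  by case: (odd k) => /=; [apply: aA|apply: QH; apply: uitH].
have vy k : iter k v y = iter k u y.
  elim: k => //= k ->; rewrite vE Hd ?uitH // orbit !scale0r !addr0 //.
have vd : iter N.+1 v d = 0.
  have -> : iter N.+1 v d = b d d *: iter N v y.
    by rewrite iterSr vE ud (sym y) (Hd yH) scale0r add0r addr0 iter_lfunZ.
  by rewrite vy uN scaler0.
have vdk k : iter N.+1 v (iter k v d) = 0 by rewrite -iterD addnC iterD vd iter_lfun0.
have vh k h : h \in H -> iter N.+1 v (iter k v h) = iter N.+1 v (iter k u h).
  elim: k h => // k IH h hH.
  rewrite (iterSr k v) (iterSr k u) vE (Hd hH) scale0r add0r.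
  by rewrite !iter_lfunD !iter_lfunZ vdk scaler0 addr0 IH ?uH.
have vW t : t \in W -> iter (N.+1 + N) v t = 0.
  move=> /WH[h [a [hH ->]]]; rewrite iter_lfunD iter_lfunZ !iterD vh // vdk uN iter_lfun0.
  by rewrite scaler0 addr0.
exists (N.+1 + N).+1 => t; rewrite iterSr vW // vE !memvD ?memvZ //.
  by apply: (subvP HW).
by apply: (subvP HW).
Qed.

Lemma anisotropic_extend : exists B, nilalt b W B /\ \dim B = (\dim A + \dim H)%N.
Proof.
have [nA' aA] := nA.
pose deltah : 'Hom(V, 'End(V)) := linfun delta.
have deltahE y : deltah y = delta y by apply: linfun_funE; apply: delta_linear.
have mem u : u \in (A + deltah @: H)%VS -> exists u' y, [/\ u' \in A, y \in H & u = (u' + delta y)%R].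
  by case/memv_addP=> u' u'A [_ /memv_imgP[y yH ->] ->]; exists u', y; rewrite deltahE.
have alt u : u \in (A + deltah @: H)%VS -> pilot_b_alternating b u.
  by move=> /mem[u' [y [u'A yH ->]]] t; rewrite (add_lfunE u') fE aA // add0r delta_alt.
have delta_d y : y \in H -> delta y d = b d d *: y.
  by move=> yH; rewrite deltaE (sym y d) (Hd yH) scale0r addr0.
have Ad u : u \in A -> u d = 0.
  move=> uA; have [_ us uH] := nA' u uA.
  by apply: (sym_range_perp0 bil sym ndV us uH).
exists (A + deltah @: H)%VS; split; first split=> //.
  move=> u uB; split; last 1 first.
  - move=> t; have [u' [y [u'A yH ->]]] := mem u uB; have [_ _ u'H] := nA' u' u'A.
    by rewrite (add_lfunE u') deltaE !memvD ?memvZ // (subvP HW).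
  - by have [u' [y [u'A yH ->]]] := mem u uB; apply: delta_nilpotent.
  - exact: (alternating_symmetric bil sym char2 (alt u uB)).
rewrite dimv_disjoint_sum.
  congr (_ + _)%N; apply: limg_dim_eq; apply/eqP; rewrite -subv0; apply/subvP=> y.
  rewrite memv0 => /memv_capP[yH]; rewrite memv_ker deltahE => /eqP y0.
  have /eqP := delta_d y yH; rewrite y0 zero_lfunE eq_sym scaler_eq0.
  by rewrite (negPf Qd).
apply/eqP; rewrite -subv0; apply/subvP=> u /memv_capP[uA /memv_imgP[y yH]].
rewrite deltahE => uE; have /eqP := delta_d y yH; rewrite -uE Ad // eq_sym scaler_eq0.
rewrite (negPf Qd) => /eqP y0; rewrite memv0 uE y0; apply/eqP/lfunP=> t.
by rewrite deltaE fE scaler0 scale0r addr0 zero_lfunE.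
Qed.

End AnisotropicLine.

(** Here [D] is a line, and its orthogonal [H] is [Ker Q], of dimension [2 * nu] and index [nu]; the
    dimensions [nu * (nu - 1)] and [2 * nu] add up to [nu * (nu + 1)]. *)
Lemma nilalt_exists_trivial_SKer nu W : nondeg_on b W -> witt_on b W nu ->
  \dim W = (2 * nu + 1)%N -> (forall t, in_SKer b W t -> t = 0) ->
  exists A, nilalt b W A /\ \dim A = (nu * (\dim W - nu))%N.
Proof.
move=> ndW wW dWn sker0.
have [D [DW DK KD dimW]] := trivial_SKer_decomp bil sym char2 ndW wW sker0.
have dD : \dim D = 1%N by lia.
pose d := vpick D; have dinD : d \in D by apply: memv_pick.
have d0 : d != 0 by rewrite vpick0 -dimv_eq0 dD.
have dW := subvP DW d dinD.
have DE : D = <[d]>%VS.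
  by apply/esym/eqP; rewrite eqEdim -memvE dinD dim_vline d0 dD.
have Qd : b d d != 0.
  apply: contra d0 => /eqP Qd; apply/eqP/sker0; split=> // s sW Qs.
  by rewrite sym DK.
pose H := (W :&: lker (form_hom b d))%VS.
have HW : (H <= W)%VS by apply: capvSl.
have HP t : t \in H <-> t \in W /\ b d t = 0.
  by rewrite memv_cap mem_hyp //; split=> [/andP[tW /eqP]|[-> ->]]; rewrite ?eqxx.
have Hd h : h \in H -> b d h = 0 by case/HP.
have QH h : h \in H -> b h h = 0.
  case/HP=> hW dh; apply: KD => // e; rewrite DE => /vlineP[a ->].
  by rewrite fE dh mulr0.
have WH t : t \in W -> exists h a, h \in H /\ t = h + a *: d.
  move=> tW; pose a := b d t / b d d; exists (t + a *: d), a; split; last first.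
    by rewrite -addrA -scalerDl -mulr2n -mulr_natl two0 mul0r scale0r addr0.
  apply/HP; split; first by rewrite memvD ?memvZ.
  by rewrite !fE divfK // -mulr2n -mulr_natl two0 mul0r.
have ndH : nondeg_on b H.
  move=> h hH hperp; have [hW dh] := proj1 (HP h) hH; apply: ndW => // t /WH[s [a [sH ->]]].
  by rewrite !fE hperp // (sym h) dh mulr0 addr0.
have wH : witt_on b H nu.
  have [[X [XW tsX dX]] wmax] := wW; split; last first.
    by move=> Y YH; apply: wmax; apply: subv_trans HW.
  exists X; split=> //; apply/subvP=> t tX; apply/HP; split; first exact: (subvP XW).
  by rewrite DK ?tsX // (subvP XW).
have dH : \dim H = (2 * nu)%N.
  have := dim_cap_lker_form W (form_hom b d); rewrite -/H dWn.
  have : (\dim (H + <[d]>) <= \dim W)%N by rewrite dimvS // subv_add HW -memvE.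
  rewrite dim_add_line ?dWn; last by apply/negP=> /HP[_ /eqP]; rewrite (negPf Qd).
  by move: (\dim H) => m; clear; lia.
have [A [nA dA]] := nilalt_exists ndH wH.
have [B [nB dB]] := anisotropic_extend dW HW Qd Hd QH WH nA.
exists B; split=> //; rewrite dB dA dH dWn.
clear; case: nu => [|k]; first by lia.
rewrite (_ : 2 * k.+1 - k.+1 - 1 = k)%N; last by lia.
rewrite (_ : 2 * k.+1 + 1 - k.+1 = k.+2)%N; last by lia.
nia.
Qed.

(** With [x] in [SKer Q], each step adds [2 * nu + 1] to [\dim A] and 1 to [\dim K], which is the
    growth of the bound; the descent ends at [SKer Q = 0]. *)
Lemma nilalt_exists_odd nu W K : nondeg_on b W -> witt_on b W nu ->
  \dim W = (2 * nu + 1)%N -> (forall t, t \in K <-> in_SKer b W t) ->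
  exists A, nilalt b W A /\ (\dim A + \dim K = nu * (\dim W - nu))%N.
Proof.
elim: nu W K => [|nu IH] W K ndW wW dWn KS; have [K0|K0] := eqVneq K 0%VS;
  try by rewrite K0 dimv0; have [|A [nA dA]] := nilalt_exists_trivial_SKer ndW wW dWn;
    [by move=> t /KS; rewrite K0 memv0 => /eqP|exists A; rewrite addn0].
  have t0 : vpick K != 0 by rewrite vpick0.
  have ts : in_SKer b W (vpick K) by apply/KS/memv_pick.
  by have [X []] := SKer_singular_vector bil sym wW ts t0.
have t0 : vpick K != 0 by rewrite vpick0.
set x := vpick K in t0; have xK : x \in K by apply: memv_pick.
have ts : in_SKer b W x by apply/KS.
have [X [XW tsX dX xX _]] := SKer_singular_vector bil sym wW ts t0.
have [z [xW zW Qx xz [nd' w' dW]]] := witt_singular_line bil sym char2 wW ndW XW tsX dX xX t0.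
have [dK K'S] := SKer_cap_plane bil sym char2 (fun t => proj1 (KS t)) xK xW zW Qx xz.
have dW' : \dim (plane_perp b x z W) = (2 * nu + 1)%N by lia.
have K'E t : t \in (K :&: lker (form_hom b z))%VS <-> in_SKer b (plane_perp b x z W) t.
  split; first exact: K'S.
  case/(SKer_plane_perp bil sym char2 xW zW Qx xz t ts) => tS zt.
  by rewrite memv_cap mem_hyp // zt eqxx andbT; apply/KS.
have [A' [nA' dA']] := IH _ _ nd' w' dW' K'E.
have [A [nA dA]] := nilalt_extend ndW wW XW tsX dX xX zW xz nA'.
exists A; split=> //; rewrite dA dK; move: dA'; rewrite dWn dW'.
move: (\dim A') (\dim (_ :&: _)) => a k; clear.
rewrite (_ : 2 * nu + 1 - nu = nu + 1)%N; last by lia.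
rewrite (_ : 2 * nu.+1 + 1 - nu.+1 = nu + 2)%N; last by lia.
nia.
Qed.

End Constructions.

(** * The three greatest dimensions on the whole space *)

Theorem theorem1p3 (F : fieldType) (V : vectType F) (b : V -> V -> F) (nu : nat) :
  2%N \in [pchar F] ->
  pilot_bil_form b -> pilot_sym_form b -> pilot_nondegenerate b ->
  pilot_witt_index b nu ->
  let n := \dim (fullv : {vspace V}) in
  [/\ pilot_greatest_dim (fun X => pilot_nilpotent_subspace X /\ pilot_sub_Sb b X) (nu * (n - nu)),
      (n <> 2 * nu + 1)%N ->
        pilot_greatest_dim (fun X => pilot_nilpotent_subspace X /\ pilot_sub_Ab b X) (nu * (n - nu - 1)) &
      (n = 2 * nu + 1)%N ->
        forall K : {vspace V}, pilot_is_SKer b K ->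
        pilot_greatest_dim (fun X => pilot_nilpotent_subspace X /\ pilot_sub_Ab b X)
                     (nu * (n - nu) - \dim K)].
Proof.
move=> char2 bil sym ndV [[X0 tsX0 dX0] wmax] n.
have nd : nondeg_on b fullv by move=> x _ x0; apply: ndV => y; apply: x0; rewrite memvf.
have wV : witt_on b fullv nu.
  by split; [exists X0; rewrite subvf|move=> X _; apply: wmax].
have symP A : nilsym b fullv A <-> pilot_nilpotent_subspace A /\ pilot_sub_Sb b A.
  split=> [nA|[nA sA] u uA]; last by split; [apply: nA|apply: sA|move=> t; apply: memvf].
  by split=> u /nA[].
have altP A : nilalt b fullv A <-> pilot_nilpotent_subspace A /\ pilot_sub_Ab b A.
  split=> [[nA aA]|[nA aA]]; first by split=> // u /nA[].
  split=> // u uA; split; [exact: nA| |move=> t; exact: memvf].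
  exact: (alternating_symmetric bil sym char2 (aA u uA)).
split.
- split=> [|A /symP nA]; last exact: (dim_nilsym_le bil sym char2 nd wV nA).
  by have [A [/symP nA dA]] := nilsym_exists bil sym char2 ndV nd wV; exists A.
- move=> nn; split=> [|A /altP nA]; last exact: (dim_nilalt_le bil sym char2 nd wV nA nn).
  by have [A [/altP nA dA]] := nilalt_exists bil sym char2 ndV nd wV; exists A.
- move=> nn K KP.
  have KS t : t \in K <-> in_SKer b fullv t.
    split=> [/KP[Qt tK]|[_ Qt tK]].
      by split=> // [|s _]; [exact: memvf|exact: tK].
    by apply/KP; split=> // y; apply: tK; rewrite memvf.
  split=> [|A /altP nA].
    have [A [/altP nA dA]] := nilalt_exists_odd bil sym char2 ndV nd wV nn KS.
    (* The dimensions of [A] and [K] add up to the product, so the truncated subtraction is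
       exact. *)
    by exists A => //; rewrite -dA addnK.
  have := dim_nilalt_le_odd bil sym char2 nd wV nA nn (fun t => proj1 (KS t)).
  by rewrite -/n; lia.
Qed.
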